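(* Let $k$ be an algebraically closed field of characteristic $0$. Suppose $\mathcal A$ and $\mathcal A'$ are fgc associative tori of nullity $n$ over $k$, $r\ge1$, and the Lie tori $\mathfrak{sl}_{r+1}(\mathcal A)$ and $\mathfrak{sl}_{r+1}(\mathcal A')$ satisfy Assumption (C). Then $\mathfrak{sl}_{r+1}(\mathcal A)$ and $\mathfrak{sl}_{r+1}(\mathcal A')$ are isomorphic if and only if $\mathcal A$ and $\mathcal A'$ are isomorphic.
   Context: For a finitely generated free abelian group $\Lambda$, an associative $\Lambda$-torus is a $\Lambda$-graded unital associative $k$-algebra $\mathcal A=\bigoplus_\lambda\mathcal A^\lambda$ with each $\mathcal A^\lambda$ spanned by an invertible element; its nullity is $\mathrm{rank}_{\mathbb Z}\Lambda$; it is fgc if finitely generated as a module over its centre. $\mathfrak{sl}_{r+1}(\mathcal A)$ is the derived algebra of $\mathrm{Mat}_{r+1}(\mathcal A)$ under the commutator product; it is an fgc centreless Lie torus of type $A_r$, with root grading the root-space decomposition relative to $\mathfrak h=\sum_{i=1}^r k(e_{ii}-e_{i+1,i+1})$ and $\Lambda$-grading induced entrywise from $\mathcal A$. Lie torus of type $(\Delta,\Lambda)$: a Lie algebra $\mathcal L$ with a $Q\times\Lambda$-grading ($Q=\mathrm{span}_{\mathbb Z}\Delta$, $\Delta$ a finite root system including $0$, $\mathcal L_\alpha=\bigoplus_\lambda\mathcal L_\alpha^\lambda$) such that $\{\alpha:\mathcal L_\alpha\ne0\}=\Delta$, $\mathcal L_\alpha^0\ne0$ for nonzero indivisible $\alpha$,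 every nonzero $\mathcal L_\alpha^\lambda$ with $\alpha\ne0$ is spanned by some $e$ with $\mathcal L_{-\alpha}^{-\lambda}=kf$ and $[[e,f],x]=\langle\beta,\alpha^\vee\rangle x$ for $x\in\mathcal L_\beta$, $\mathcal L$ is generated by the $\mathcal L_\alpha$ ($\alpha\ne0$), and $\Lambda$ is generated by the $\Lambda$-support. Centroid: $\{c\in\mathrm{End}_k\mathcal L:c[x,y]=[cx,y]=[x,cy]\}$. An fgc centreless Lie algebra $\mathcal L$ satisfies Assumption (C) if: whenever $\mathcal L$ carries a Lie torus structure of type $(\Delta,\Lambda)$ with $\mathfrak h=\mathcal L_0^0$ and (the same algebra) $\mathcal L$ carries a Lie torus structure of type $(\Delta',\Lambda')$ with degree-$(0,0)$ component $\mathfrak h'$, there exists an automorphism $\varphi$ of $\mathcal L$ with $\varphi(\mathfrak h)=\mathfrak h'$. *)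

(* Defs.v *)
From HB Require Import structures.
From mathcomp Require Import all_boot all_order all_algebra.
Set Implicit Arguments. Unset Strict Implicit. Unset Printing Implicit Defensive.
Import Order.TTheory GRing.Theory Num.Theory.
Local Open Scope ring_scope.

(* Lie algebras are given concretely as a k-subspace [S] of an ambient        *)
(* additive group [V] (with a k-scaling [sc]) that is closed under a bracket   *)
(* [br]. Only the elements of [S] belong to the Lie algebra; all notions      *)
(* below are relative to [S].                                                  *)

Definition subspace (k : fieldType) (V : zmodType) (sc : k -> V -> V)
  (P : V -> Prop) : Prop :=
  P 0 /\ forall (a : k) x y, P x -> P y -> P (sc a x + y).

Definition linear_on (k : fieldType) (V V' : zmodType)
  (sc : k -> V -> V) (sc' : k -> V' -> V') (S : V -> Prop) (f : V -> V') :=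
  forall (a : k) x y, S x -> S y -> f (sc a x + y) = sc' a (f x) + f y.

Definition lie_isom (k : fieldType) (V V' : zmodType)
  (sc : k -> V -> V) (br : V -> V -> V) (S : V -> Prop)
  (sc' : k -> V' -> V') (br' : V' -> V' -> V') (S' : V' -> Prop)
  (f : V -> V') : Prop :=
  [/\ (forall x, S x -> S' (f x)),
      linear_on sc sc' S f,
      (forall x y, S x -> S y -> f x = f y -> x = y),
      (forall y, S' y -> exists2 x, S x & f x = y) &
      (forall x y, S x -> S y -> f (br x y) = br' (f x) (f y))].

Definition lie_isomorphic (k : fieldType) (V V' : zmodType)
  (sc : k -> V -> V) (br : V -> V -> V) (S : V -> Prop)
  (sc' : k -> V' -> V') (br' : V' -> V' -> V') (S' : V' -> Prop) : Prop :=
  exists f : V -> V', lie_isom sc br S sc' br' S' f.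

Definition lie_aut (k : fieldType) (V : zmodType)
  (sc : k -> V -> V) (br : V -> V -> V) (S : V -> Prop) (f : V -> V) :=
  lie_isom sc br S sc br S f.

Definition centroid_elt (k : fieldType) (V : zmodType)
  (sc : k -> V -> V) (br : V -> V -> V) (S : V -> Prop) (c : V -> V) :=
  [/\ (forall x, S x -> S (c x)), linear_on sc sc S c &
      forall x y, S x -> S y -> c (br x y) = br (c x) y /\ c (br x y) = br x (c y)].

Definition lie_fgc (k : fieldType) (V : zmodType)
  (sc : k -> V -> V) (br : V -> V -> V) (S : V -> Prop) :=
  exists s : seq V, (forall v, v \in s -> S v) /\
    forall x, S x -> exists cs : nat -> V -> V,
      (forall i, centroid_elt sc br S (cs i)) /\
      x = \sum_(i < size s) cs i (nth 0 s i).

Definition lie_centreless (V : zmodType)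
  (br : V -> V -> V) (S : V -> Prop) :=
  forall z, S z -> (forall x, S x -> br z x = 0) -> z = 0.

Definition is_coroot (m : nat) (Delta : seq 'rV[rat]_m) (alpha : 'rV[rat]_m)
  (cor : 'rV[rat]_m -> rat) : Prop :=
  [/\ (forall (a : rat) x y, cor (a *: x + y) = a * cor x + cor y),
      cor alpha = 2,
      (forall beta, beta \in Delta -> cor beta \is a Num.int) &
      (forall beta, beta \in Delta -> beta - cor beta *: alpha \in Delta)].

(* Delta is a finite root system (possibly non-reduced) together with 0, *)
(* spanning its ambient space Q^m                                         *)
Definition root_system0 (m : nat) (Delta : seq 'rV[rat]_m) : Prop :=
  [/\ 0 \in Delta,
      (<<Delta>>%VS = fullv) &
      forall alpha, alpha \in Delta -> alpha != 0 ->
        exists cor, is_coroot Delta alpha cor].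

(* G a l x  means  x belongs to the homogeneous component L_a^l,              *)
(* a in Q^m (root grading, supported on Delta), l in Lambda = Z^p.            *)

Definition lie_torus (k : fieldType) (V : zmodType)
  (sc : k -> V -> V) (br : V -> V -> V) (S : V -> Prop)
  (m p : nat) (Delta : seq 'rV[rat]_m)
  (G : 'rV[rat]_m -> 'rV[int]_p -> V -> Prop) : Prop :=
  let comp_nz a l := exists2 x, G a l x & x != 0 in
  let Gsum a x := exists s : seq ('rV[int]_p * V),
      (forall u, u \in s -> G a u.1 u.2) /\ x = \sum_(u <- s) u.2 in
  [/\ root_system0 Delta,
      [/\
      (forall a l, subspace sc (G a l) /\ forall x, G a l x -> S x),
      (forall x, S x -> exists s : seq ('rV[rat]_m * 'rV[int]_p * V),
          (forall u, u \in s -> G u.1.1 u.1.2 u.2) /\ x = \sum_(u <- s) u.2),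
      (forall s : seq ('rV[rat]_m * 'rV[int]_p * V),
          uniq (map fst s) -> (forall u, u \in s -> G u.1.1 u.1.2 u.2) ->
          \sum_(u <- s) u.2 = 0 -> forall u, u \in s -> u.2 = 0) &
      (forall a b l l' x y, G a l x -> G b l' y -> G (a + b) (l + l') (br x y))],
      (forall a, (exists l, comp_nz a l) <-> a \in Delta) &
      [/\
          (forall a, a \in Delta -> a != 0 -> (2%:R)^-1 *: a \notin Delta ->
             comp_nz a 0),
          (forall a l, a != 0 -> comp_nz a l ->
             exists e f, [/\ (forall x, G a l x <-> exists c, x = sc c e),
                 (forall x, G (- a) (- l) x <-> exists c, x = sc c f) &
                 forall cor, is_coroot Delta a cor ->
                 forall b x, Gsum b x ->
                   br (br e f) x = sc (ratr (cor b)) x]),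
          (forall x, S x <-> (forall P : V -> Prop, subspace sc P ->
               (forall y z, P y -> P z -> P (br y z)) ->
               (forall a l y, a != 0 -> G a l y -> P y) -> P x)) &
          (forall mu : 'rV[int]_p, exists s : seq (int * 'rV[int]_p),
             (forall u, u \in s -> exists a, comp_nz a u.2) /\
             mu = \sum_(u <- s) u.1 *: u.2)]].

Definition assumptionC (k : fieldType) (V : zmodType)
  (sc : k -> V -> V) (br : V -> V -> V) (S : V -> Prop) : Prop :=
  [/\ lie_fgc sc br S, lie_centreless br S &
  forall (m p : nat) (Delta : seq 'rV[rat]_m)
         (G : 'rV[rat]_m -> 'rV[int]_p -> V -> Prop)
         (m' p' : nat) (Delta' : seq 'rV[rat]_m')
         (G' : 'rV[rat]_m' -> 'rV[int]_p' -> V -> Prop),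
    lie_torus sc br S Delta G -> lie_torus sc br S Delta' G' ->
    exists phi, lie_aut sc br S phi /\
      forall y, G' 0 0 y <-> exists2 x, G 0 0 x & y = phi x].

Definition invertible (A : nzRingType) (u : A) := exists v, u * v = 1 /\ v * u = 1.

(* Gr l x : x belongs to A^l, l in Lambda = Z^n *)
Definition assoc_torus_grading (k : fieldType) (A : algType k) (n : nat)
  (Gr : 'rV[int]_n -> A -> Prop) : Prop :=
  [/\ (forall l, subspace (fun c (x : A) => c *: x) (Gr l)),
      (forall x : A, exists s : seq ('rV[int]_n * A),
          (forall u, u \in s -> Gr u.1 u.2) /\ x = \sum_(u <- s) u.2),
      (forall s : seq ('rV[int]_n * A),
          uniq (map fst s) -> (forall u, u \in s -> Gr u.1 u.2) ->
          \sum_(u <- s) u.2 = 0 -> forall u, u \in s -> u.2 = 0),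
      (forall l l' x y, Gr l x -> Gr l' y -> Gr (l + l') (x * y)) &
      (forall l, exists u, invertible u /\ forall x, Gr l x <-> exists c : k, x = c *: u)].

Definition assoc_torus (k : fieldType) (A : algType k) (n : nat) : Prop :=
  exists Gr : 'rV[int]_n -> A -> Prop, assoc_torus_grading Gr.

Definition assoc_fgc (k : fieldType) (A : algType k) : Prop :=
  exists s : seq A, forall x : A, exists zs : nat -> A,
    (forall i y, zs i * y = y * zs i) /\
    x = \sum_(i < size s) zs i * nth 0 s i.

Definition alg_isomorphic (k : fieldType) (A A' : algType k) : Prop :=
  exists f : {lrmorphism A -> A'}, bijective f.

Definition mat_sc (k : fieldType) (A : algType k) (N : nat) (c : k)
  (X : 'M[A]_N) : 'M[A]_N := map_mx (fun x => c *: x) X.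

Definition mat_br (k : fieldType) (A : algType k) (N : nat)
  (X Y : 'M[A]_N) : 'M[A]_N := X *m Y - Y *m X.

Definition sl_set (k : fieldType) (A : algType k) (N : nat) (X : 'M[A]_N) : Prop :=
  exists s : seq (k * 'M[A]_N * 'M[A]_N),
    X = \sum_(u <- s) mat_sc u.1.1 (mat_br u.1.2 u.2).

(* Main.v *)
Require Import Defs.
From HB Require Import structures.
From mathcomp Require Import all_boot all_order all_fingroup all_algebra.
From mathcomp Require Import cyclic separable cyclotomic ring.
From Stdlib Require Import ClassicalEpsilon IndefiniteDescription.
Set Implicit Arguments. Unset Strict Implicit. Unset Printing Implicit Defensive.
Import Order.TTheory GRing.Theory Num.Theory.
Local Open Scope ring_scope.

(* Transporting the standard Lie torus structure of sl(A') to sl(A) and applying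
   Assumption (C) gives an isomorphism F that matches the two Cartan subalgebras.
   Hence F maps the root spaces A e_0r and A e_r0 onto A' e_pq and into A' e_qp.
   The triple product [[x e_0r, y e_r0], z e_0r] = (xyz + zyx) e_0r then yields a
   unital Jordan isomorphism A -> A'; as A' is a domain, it is an isomorphism or an
   anti-isomorphism. In the second case compose with an anti-automorphism of A',
   which exists because A' is fgc: the commutation bicharacter of Z^n takes values
   in the roots of unity, so it is zeta^(l B m^T) with B an integral skew matrix,
   and some g in GL_n(Z) satisfies g^T B g = - B. *)

(** * Skew-symmetric integer matrices *)

(** The anti-isomorphism case cannot be avoided: X |-> -X^T identifies the Lie algebra over A with
    the one over the opposite algebra, for every r, so the theorem contains the claim that A is
    isomorphic to its opposite. Reversing the product inverts the commutation bicharacter, hence the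
    search for a base change of Z^n that inverts it. Once the values are roots of unity this
    concerns a single integral skew matrix, which reduces to 2 by 2 blocks, where a matrix of
    determinant -1 changes the sign. A Lie isomorphism need not respect either grading, and
    Assumption (C) controls only the degree-(0,0) spaces. Roots are therefore recovered from
    eigenvalues: in type A the coroot of alpha takes the value 2 on no root but alpha, so each root
    space is an eigenspace of one Cartan element. One opposite pair of root spaces carries the whole
    Jordan structure of A, and such a pair exists already for r = 1, so all ranks are treated
    alike. *)

Definition skew_mx n (B : 'M[int]_n) := B^T = - B.

Definition negatable n (B : 'M[int]_n) :=
  exists2 g : 'M[int]_n, g \in unitmx & g^T *m B *m g = - B.

Lemma skew_congr n (B h : 'M[int]_n) : skew_mx B -> skew_mx (h^T *m B *m h).
Proof. by move=> skB; rewrite /skew_mx !trmx_mul skB trmxK mulmxA mulmxN mulNmx. Qed.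

Lemma negatable_congr n (B h : 'M[int]_n) :
  h \in unitmx -> negatable (h^T *m B *m h) -> negatable B.
Proof.
move=> hu [g gu Hg]; exists (h *m g *m invmx h).
  by rewrite !unitmx_mul hu gu unitmx_inv hu.
have -> : (h *m g *m invmx h)^T *m B *m (h *m g *m invmx h) =
  (invmx h)^T *m (g^T *m (h^T *m B *m h) *m g) *m invmx h.
  by rewrite !trmx_mul !mulmxA.
rewrite Hg mulmxN mulNmx !mulmxA -trmx_mul mulmxV // trmx1 mul1mx.
by rewrite -mulmxA mulmxV // mulmx1.
Qed.

Lemma skew_diag n (B : 'M[int]_n) i : skew_mx B -> B i i = 0.
Proof.
move=> /matrixP/(_ i i); rewrite !mxE => /eqP.
by rewrite -subr_eq0 opprK -mulr2n mulrn_eq0 => /eqP.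
Qed.

Lemma skew_swap n (B : 'M[int]_n) i j : skew_mx B -> B j i = - B i j.
Proof. by move=> /matrixP/(_ i j); rewrite !mxE. Qed.

(** The standard symplectic matrix, with rows (0, 1) and (-1, 0). *)
Definition symp2 : 'M[int]_2 := \matrix_(i, j) ((i < j)%N%:R - (j < i)%N%:R).

Lemma symp2_sq : symp2 *m symp2 = - 1%:M.
Proof.
apply/matrixP => i j; rewrite !mxE big_ord_recl big_ord1 !mxE.
by case: i j => [[|[|i]] Hi] [[|[|j]] Hj].
Qed.

Lemma skew2E (B : 'M[int]_2) : skew_mx B -> B = B 0 1 *: symp2.
Proof.
move=> skB; apply/matrixP => i j; rewrite !mxE.
have ordE (a : 'I_2) : a = 0 \/ a = 1.
  by case: a => [[|[|]]] //= H; [left|right]; apply: val_inj.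
have [->|->] := ordE i; have [->|->] := ordE j;
  by rewrite ?skew_diag // ?(skew_swap 0 1 skB) /= ?subrr ?subr0 ?sub0r ?mulr0 ?mulr1 ?mulrN1.
Qed.

(** A 2 by 2 matrix acts on [symp2] by congruence through its determinant. The matrix [f] = diag(1,
    -1) has determinant -1, so it negates the first block for any [d]. *)
Lemma negatable_block n (d : int) (Z : 'M[int]_n) :
  negatable Z -> negatable (block_mx (d *: symp2) 0 0 Z : 'M_(2 + n)).
Proof.
move=> [g gu Hg]; pose f : 'M[int]_2 := \matrix_(i, j) ((i == j)%:R * (-1) ^+ i).
exists (block_mx f 0 0 g : 'M_(2 + n)).
  rewrite unitmxE det_ublock unitrM -!unitmxE gu andbT.
  suff /mulmx1_unit[] : f *m f = 1%:M by [].
  apply/matrixP => i j; rewrite !mxE big_ord_recl big_ord1 !mxE.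
  by case: i j => [[|[|i]] Hi] [[|[|j]] Hj].
rewrite tr_block_mx !mulmx_block !trmx0 !mulmx0 !mul0mx !addr0 !add0r Hg.
rewrite opp_block_mx !oppr0 !mul0mx; congr block_mx.
rewrite -scalemxAr -scalemxAl -scalerN; congr (_ *: _).
apply/matrixP => i j; rewrite !(mxE, big_ord_recl, big_ord0).
by case: i j => [[|[|i]] Hi] [[|[|j]] Hj].
Qed.

(* When the corner entry [d] is the least positive entry over the congruence class, reducing the first two rows modulo [d] by a congruence must give zero. *)
Lemma skew_mx_split n (d : nat) (C : 'M[int]_(2 + n)) :
  skew_mx C -> (0 < d)%N -> C (lshift n 0) (lshift n 1) = d%:Z ->
  (forall (h : 'M[int]_(2 + n)) e a b, h \in unitmx -> (0 < e)%N ->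
    (h^T *m C *m h) a b = e%:Z -> (d <= e)%N) ->
  exists h (Z : 'M[int]_n), [/\ h \in unitmx, skew_mx Z &
    h^T *m C *m h = block_mx (d%:Z *: symp2) 0 0 Z].
Proof.
move=> skC d0 h01 dmin.
pose P := ulsubmx C; pose X := ursubmx C; pose Z := drsubmx C.
have CE : C = block_mx P X (- X^T) Z.
  rewrite -[LHS]submxK; congr block_mx; rewrite trmx_ursub skC.
  by apply/matrixP => i j; rewrite !mxE opprK.
have PE : P = d%:Z *: symp2.
  rewrite [P]skew2E; last first.
    by rewrite /skew_mx trmx_ulsub skC; apply/matrixP => i j; rewrite !mxE.
  by congr (_ *: _); rewrite !mxE -h01.
(* Entrywise quotients by [d]. Since [symp2] squares to -1, the congruence by [h] subtracts d Q from
   [X] and leaves the remainders. *)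
pose Q : 'M[int]_(2, n) := map_mx (divz^~ d%:Z) X.
pose h : 'M[int]_(2 + n) := block_mx 1%:M (symp2 *m Q) 0 1%:M.
have hu : h \in unitmx by rewrite unitmxE det_ublock !det1 mulr1.
have uR : ursubmx (h^T *m C *m h) = map_mx (modz^~ d%:Z) X.
  rewrite CE /h tr_block_mx !mulmx_block block_mxKur trmx1 trmx0.
  rewrite !mulmx1 !mul1mx !mul0mx !addr0 PE -scalemxAl mulmxA symp2_sq mulNmx mul1mx.
  rewrite /Q; move: (X) => X'.
  by apply/matrixP => a b; rewrite !mxE {2}(divz_eq (X' a b) d) mulrC mulNr addKr.
have R0 : map_mx (modz^~ d%:Z) X = 0.
  apply/matrixP => a b; rewrite [RHS]mxE; apply/eqP/negPn/negP => Rab.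
  have dn0 : d%:Z != 0 by rewrite eqz_nat -lt0n.
  have : (d <= `|(map_mx (modz^~ d%:Z) X) a b|)%N.
    apply: (dmin h _ (lshift n a) (rshift 2 b) hu); first by rewrite absz_gt0.
    by rewrite -[h^T *m C *m h]submxK uR block_mxEur gez0_abs // mxE modz_ge0.
  rewrite leqNgt -ltz_nat gez0_abs ?mxE ?modz_ge0 //.
  by rewrite ltz_mod.
have skh := skew_congr h skC.
exists h, (drsubmx (h^T *m C *m h)); split=> //.
  by rewrite /skew_mx trmx_drsub skh; apply/matrixP => i j; rewrite !mxE.
rewrite -[LHS]submxK uR R0; congr block_mx.
  rewrite CE /h tr_block_mx !mulmx_block block_mxKul trmx1 trmx0.
  by rewrite !mulmx1 !mul1mx !mul0mx !addr0 !mulmx0 addr0 PE.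
apply: trmx_inj; rewrite trmx_dlsub skh trmx0 -[RHS]oppr0 -R0 -uR.
by apply/matrixP => i j; rewrite !mxE.
Qed.

(** Descent on the size. If some matrix congruent to [B] has a positive entry, the least such entry
    [d] divides the two rows that meet it, so a block [d *: symp2] splits off and two rows fewer
    remain. Otherwise [B] is zero and the identity works. *)
Lemma skew_mx_negatable n (B : 'M[int]_n) : skew_mx B -> negatable B.
Proof.
elim/ltn_ind: n B => n IHn B skB.
pose D d := exists h : 'M[int]_n, exists i j,
  [/\ h \in unitmx, (0 < d)%N & (h^T *m B *m h) i j = d%:Z].
have [[d Dd]|noD] := classic (exists d, D d); last first.
  exists 1%:M; first exact: unitmx1.
  rewrite trmx1 mul1mx mulmx1; suff -> : B = 0 by rewrite oppr0.
  apply/matrixP => i j; rewrite mxE; apply/eqP/negPn/negP => Bij.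
  (* By skewness a negative entry has a positive mirror image, so it is enough to exclude positive
     entries. *)
  have Dpos a b : 0 < B a b -> False.
    move=> Bab; apply: noD; exists `|B a b|%N, 1%:M, a, b.
    rewrite unitmx1 absz_gt0 gt_eqF // trmx1 mul1mx mulmx1 gtz0_abs //.
  case: (ltrgtP (B i j) 0) Bij => // Bij _; last exact: Dpos Bij.
  by apply: (Dpos j i); rewrite (skew_swap i j skB) oppr_gt0.
have {Dd} [{}d Dd dmin] : exists2 d, D d & forall e, D e -> (d <= e)%N.
  elim/ltn_ind: d Dd => d IHd Dd.
  have [[e [De ed]]|nD] := classic (exists e, D e /\ (e < d)%N); first exact: IHd De.
  by exists d => // e De; rewrite leqNgt; apply/negP => ed; apply: nD; exists e.
have [h [i [j [hu d0 hij]]]] := Dd.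
apply: (negatable_congr hu).
have {dmin Dd} dmin (h' : 'M_n) e a b : h' \in unitmx -> (0 < e)%N ->
    (h'^T *m (h^T *m B *m h) *m h') a b = e%:Z -> (d <= e)%N.
  move=> h'u e0 He; apply: dmin; exists (h *m h'), a, b; split=> //.
    by rewrite unitmx_mul hu.
  by rewrite -He trmx_mul !mulmxA.
move: (skew_congr h skB) dmin hij; move: (h^T *m B *m h) => C skC dmin hij.
clear h hu D B skB.
case: n i j C skC dmin hij IHn => [|[|n]] i j B skB dmin hij IHn; first by have := ltn_ord i.
  by move: hij; rewrite !ord1 skew_diag // => -[] d0'; rewrite -d0' in d0.
have ij : i != j by apply: contraTneq d0 => ij; move: hij; rewrite ij skew_diag // => -[<-].
(* A permutation congruence moves the entry [d] from (i, j) to (0, 1), where [skew_mx_split] expects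
   it. *)
have [s [si sj]] : exists s : 'S_n.+2, s 0 = i /\ s 1 = j.
  exists (tperm 1%R (tperm 0%R i j) * tperm 0%R i)%g; rewrite !permM.
  rewrite [tperm 1 _ 1]tpermL tpermK; split=> //.
  rewrite [tperm 1 _ 0]tpermD ?tpermL //.
  by rewrite -(inj_eq (@perm_inj _ (tperm 0 i))) tpermK tpermL eq_sym.
have hu : perm_mx (R := int) s^-1%g \in unitmx by exact: unitmx_perm.
apply: (negatable_congr hu).
have h01 : ((perm_mx s^-1%g)^T *m B *m perm_mx s^-1%g) 0 1 = d%:Z.
  by rewrite tr_perm_mx invgK -row_permE -col_permE !mxE si sj.
have {}dmin h e a b : h \in unitmx -> (0 < e)%N ->
    (h^T *m ((perm_mx s^-1%g)^T *m B *m perm_mx s^-1%g) *m h) a b = e%:Z -> (d <= e)%N.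
  move=> h'u e0 He; apply: (dmin (perm_mx s^-1%g *m h) e a b) => //.
    by rewrite unitmx_mul hu.
  by rewrite -He trmx_mul !mulmxA.
move: (skew_congr (perm_mx s^-1%g) skB) dmin h01.
move: ((perm_mx s^-1%g)^T *m B *m perm_mx s^-1%g) => C skC dmin h01.
have [|h [Z [hu' skZ hC]]] := @skew_mx_split n d C skC d0 _ dmin.
  by rewrite -h01; congr (C _ _); apply: val_inj.
apply: (negatable_congr hu'); rewrite hC.
exact/negatable_block/IHn.
Qed.

(** * Bicharacters and symmetric cocycles on Z^n *)

(** In characteristic 0 the polynomial X^M - 1 is separable, so it has M distinct roots in [k]; that
    many M-th roots of unity must include a primitive one. *)
Lemma closed_prim_root (k : closedFieldType) (M : nat) :
  [pchar k] =i pred0 -> (0 < M)%N -> exists z : k, M.-primitive_root z.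
Proof.
move=> chk M0.
have MN0 : M%:R != 0 :> k by rewrite ((pcharf0P k).1 chk) -lt0n.
have [rs Hrs] := closed_field_poly_normal ('X^M - 1 : {poly k}).
rewrite lead_coefXnsubC // scale1r in Hrs.
have /hasP[z _ zM] : has M.-primitive_root rs.
  apply: has_prim_root => //.
  - apply/allP => x xrs; rewrite /root_of_unity Hrs root_prod_XsubC.
    exact: xrs.
  - by rewrite -separable_prod_XsubC -Hrs separable_Xn_sub_1.
  - by rewrite -ltnS -(size_prod_XsubC rs id) -Hrs size_XnsubC.
by exists z.
Qed.

Lemma mulchar_ext (k : fieldType) n (f g : 'rV[int]_n -> k) :
  (forall l m, f (l + m) = f l * f m) -> (forall l m, g (l + m) = g l * g m) ->
  (forall l, f l != 0) -> (forall l, g l != 0) ->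
  (forall i, f (delta_mx 0 i) = g (delta_mx 0 i)) -> f =1 g.
Proof.
move=> fD gD f0 g0 fg l.
have fe : f 0 = 1 by apply: (mulIf (f0 0)); rewrite -fD addr0 mul1r.
have ge : g 0 = 1 by apply: (mulIf (g0 0)); rewrite -gD addr0 mul1r.
pose P l := f l = g l.
have PD x y : P x -> P y -> P (x + y) by rewrite /P fD gD => -> ->.
have PN x : P x -> P (- x).
  by move=> Px; apply: (mulIf (f0 x)); rewrite -fD addNr Px -gD addNr fe ge.
have PZ (a : int) x : P x -> P (a *: x).
  move=> Px; have Pn (j : nat) : P (j%:Z *: x).
    elim: j => [|j IH]; first by rewrite scale0r /P fe ge.
    by rewrite intS scalerDl scale1r; apply: PD.
  by case: (intP a) => [|j|j]; rewrite ?scaleNr; [exact: (Pn 0)|exact: Pn|exact/PN/Pn].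
rewrite [l]row_sum_delta -/(P _).
elim/big_ind: _ => [||i _]; [by rewrite /P fe ge|by move=> x y; apply: PD|exact/PZ/fg].
Qed.

Lemma bichar_log (k : fieldType) n M (z : k) (b : 'rV[int]_n -> 'rV[int]_n -> k) :
  M.-primitive_root z ->
  (forall l l' m, b (l + l') m = b l m * b l' m) ->
  (forall l m m', b l (m + m') = b l m * b l m') ->
  (forall l m, b l m * b m l = 1) -> (forall l, b l l = 1) ->
  (forall l m, b l m ^+ M = 1) ->
  exists2 B : 'M[int]_n, skew_mx B & forall l m, b l m = z ^ ((l *m B *m m^T) 0 0).
Proof.
move=> zM bDl bDr bC bd bM.
have M0 := prim_order_gt0 zM.
have z0 : z != 0 by rewrite (prim_root_eq0 zM) -lt0n.
have b0 l m : b l m != 0.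
  by apply/eqP => H; move/eqP: (bM l m); rewrite H expr0n gtn_eqF // eq_sym oner_eq0.
pose lg i j := val (sval (prim_rootP zM (bM (delta_mx 0 i) (delta_mx 0 j)))).
have lgE i j : b (delta_mx 0 i) (delta_mx 0 j) = z ^ (lg i j)%:Z.
  by rewrite /lg; case: prim_rootP.
(* Logarithms are defined only modulo [M], so [lg j i] need not be the opposite of [lg i j]. Keeping
   those with i < j and extending by sign makes [B] exactly skew. *)
pose B : 'M[int]_n := \matrix_(i, j)
  if (i < j)%N then (lg i j)%:Z else if (j < i)%N then - (lg j i)%:Z else 0.
exists B.
  by apply/matrixP => i j; rewrite !mxE; case: ltngtP; rewrite ?oppr0 ?opprK.
(* Both sides are characters in [m] for fixed [l], and in [l] for fixed [m], so comparing them on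
   pairs of basis vectors is enough. *)
apply: (fun H l => mulchar_ext (H l).1 (H l).2.1 (b0 l) (H l).2.2.1 (H l).2.2.2).
move=> l; split; [exact: bDr|split; [|split]].
- by move=> m m'; rewrite linearD mulmxDr mxE expfzDr.
- by move=> m; rewrite expfz_neq0.
move=> j; move: l; apply: mulchar_ext => //.
- by move=> m m'; rewrite !mulmxDl mxE expfzDr.
- by move=> m; rewrite expfz_neq0.
move=> i; rewrite trmx_delta -rowE -colE !mxE.
case: ltngtP => [ij|ji|/val_inj->]; first exact: lgE.
  by apply: (mulIf (b0 (delta_mx 0 j) (delta_mx 0 i))); rewrite bC lgE -expfzDr // addNr.
by rewrite bd.
Qed.

Section CocycleExtension.

Variables (k : fieldType) (n : nat) (c : 'rV[int]_n -> 'rV[int]_n -> k).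

Record symmetric_cocycle : Prop := SymmetricCocycle {
  cocycle_neq0 : forall l m, c l m != 0;
  cocycleC : forall l m, c l m = c m l;
  cocycleA : forall l m p, c l m * c (l + m) p = c m p * c l (m + p)
}.

Hypothesis cP : symmetric_cocycle.

(* The carrier is indexed by the cocycle proof so that the group structure can be found by unification. *)
Definition cocycle_ext & symmetric_cocycle : Type :=
  ('rV[int]_n * {a : k | a != 0})%type.

Local Notation E := (cocycle_ext cP).
HB.instance Definition _ := Choice.on E.

Definition ext_pair l (a : k) (a0 : a != 0) : E := (l, exist _ a a0).

Let mul_neq0 (a b : k) : a != 0 -> b != 0 -> a * b != 0.
Proof. by move=> a0 b0; rewrite mulf_neq0. Qed.

Let inv_neq0 (a : k) : a != 0 -> a^-1 != 0.
Proof. by rewrite invr_eq0. Qed.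

(** The group law of the central extension of Z^n by the units of [k] with cocycle [c]; it is
    abelian because [c] is symmetric. *)
Definition ext_add (x y : E) : E :=
  ext_pair (x.1 + y.1)
    (mul_neq0 (mul_neq0 (svalP x.2) (svalP y.2)) (cocycle_neq0 cP x.1 y.1)).

(** As [c] is not normalised, the neutral element has second component c(0, 0)^-1 instead of 1. *)
Definition ext_zero : E := ext_pair 0 (inv_neq0 (cocycle_neq0 cP 0 0)).

Definition ext_opp (x : E) : E :=
  ext_pair (- x.1) (inv_neq0 (mul_neq0 (mul_neq0 (svalP x.2)
    (cocycle_neq0 cP x.1 (- x.1))) (cocycle_neq0 cP 0 0))).

Let ext_eq (x y : E) : x.1 = y.1 -> sval x.2 = sval y.2 -> x = y.
Proof. by case: x y => [l [a a0]] [m [b b0]] /= -> H; congr pair; apply: val_inj. Qed.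

Let cocycle0 l : c 0 l = c 0 0.
Proof.
have := cocycleA cP 0 0 l; rewrite !add0r => H.
by apply/esym/(mulIf (cocycle_neq0 cP 0 l)).
Qed.

Lemma ext_addA : associative ext_add.
Proof.
move=> x y z; apply: ext_eq => /=; first by rewrite addrA.
rewrite -!mulrA; congr (_ * (_ * _)).
by rewrite [RHS]mulrCA (cocycleA cP).
Qed.

Lemma ext_addC : commutative ext_add.
Proof.
by move=> x y; apply: ext_eq => /=; rewrite 1?addrC // mulrC (mulrC (sval x.2)) mulrC (cocycleC cP).
Qed.

Lemma ext_add0 : left_id ext_zero ext_add.
Proof.
move=> x; apply: ext_eq => /=; first by rewrite add0r.
by rewrite cocycle0 mulrAC mulVf ?mul1r ?cocycle_neq0.
Qed.

Lemma ext_addN : left_inverse ext_zero ext_opp ext_add.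
Proof.
move=> x; apply: ext_eq => /=; first by rewrite addNr.
have := cocycle_neq0 cP x.1 (- x.1); have := svalP x.2; have := cocycle_neq0 cP 0 0.
rewrite (cocycleC cP (- x.1)).
move: (c _ _) (sval _) (c _ _) => a b d a0 b0 d0.
by rewrite !invfM [_ * b]mulrC !mulrA mulfV // mul1r mulrAC mulVf // mul1r.
Qed.

HB.instance Definition _ := GRing.isZmodule.Build E ext_addA ext_addC ext_add0 ext_addN.

(** An abelian extension of the free group Z^n splits: lift the basis vectors and extend additively.
    The scalar component of this section is [d]. *)
Lemma symmetric_cocycle_split :
  exists d : 'rV[int]_n -> k,
    (forall l, d l != 0) /\ forall l m, d l * d m * c l m = d (l + m).
Proof.
pose s (l : 'rV[int]_n) : E := \sum_i ext_pair (delta_mx 0 i) (oner_neq0 k) *~ l 0 i.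
have sD l m : s (l + m) = s l + s m.
  by rewrite /s -big_split; apply: eq_bigr => i _; rewrite mxE mulrzDr.
have fD (x y : E) : (x + y).1 = x.1 + y.1 by [].
have f0 : (0 : E).1 = 0 by [].
have fN (x : E) : (- x).1 = - x.1 by [].
have fn (x : E) j : (x *+ j).1 = x.1 *+ j.
  by elim: j => // j IH; rewrite !mulrS fD IH.
have fZ (x : E) a : (x *~ a).1 = x.1 *~ a.
  by case: (intP a) => [|j|j]; rewrite ?mulr0z // -?nmulrn -?pmulrn ?fN fn.
have s1 l : (s l).1 = l.
  rewrite [RHS]row_sum_delta /s; elim/big_rec2: _ => // i x y _ <-.
  by rewrite fD fZ -scaler_int intz.
exists (fun l => sval (s l).2); split=> [l|l m]; first exact: (svalP (s l).2).
by rewrite sD /= !s1.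
Qed.

End CocycleExtension.

(** * Associative tori *)

Lemma big_uniq_supp (V : nmodType) (I : eqType) (s t : seq I) (F : I -> V) :
  uniq s -> uniq t -> (forall i, i \notin s -> F i = 0) ->
  (forall i, i \notin t -> F i = 0) -> \sum_(i <- s) F i = \sum_(i <- t) F i.
Proof.
have aux (s' t' : seq I) : uniq s' -> uniq t' -> (forall i, i \notin s' -> F i = 0) ->
    \sum_(i <- t') F i = \sum_(i <- t' | i \in s') F i.
  move=> us ut Fs; rewrite (bigID (mem s')) /= [X in _ + X]big1 ?addr0 //.
move=> us ut Fs Ft; rewrite (aux t s) // (aux s t) // -big_filter -[RHS]big_filter.
apply: perm_big; apply: uniq_perm; rewrite ?filter_uniq // => i.
by rewrite !mem_filter andbC.
Qed.

Lemma seq_max (T : eqType) (f : T -> int) (s : seq T) : s != [::] ->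
  exists2 x, x \in s & forall y, y \in s -> f y <= f x.
Proof.
elim: s => // x s IH _; have [->|/IH[y ys ymax]] := eqVneq s [::].
  by exists x; rewrite ?mem_head // => y; rewrite inE => /eqP->.
case: (leP (f y) (f x)) => [yx|/ltW xy].
  exists x; first exact: mem_head.
  by move=> w; rewrite inE => /predU1P[->//|/ymax/le_trans]; apply.
exists y; first by rewrite inE ys orbT.
by move=> w; rewrite inE => /predU1P[->//|/ymax].
Qed.

(* A linear form that is injective on the two supports has a unique maximum on each, so the corresponding product cannot be cancelled. *)
Lemma int_form_separates n (s : seq 'rV[int]_n) : exists f : 'rV[int]_n -> int,
  (forall l m, f (l + m) = f l + f m) /\ {in s &, injective f}.
Proof.
(* Vectors are read as polynomials and evaluated at an integer [t]. This is additive, and it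
   separates [s] once [t] is not a root of any nonzero difference, that is, of the product [p]. *)
pose D := [seq l - m | l <- s, m <- s]; pose p : {poly int} := \prod_(v <- D | v != 0) rVpoly v.
have p0 : p != 0.
  rewrite /p prodf_seq_neq0; apply/allP => v _; apply/implyP; apply: contra => /eqP v0.
  by rewrite -[v]rVpolyK v0 linear0.
have [t pt] : exists t : int, p.[t] != 0.
  apply: NNPP => nex; pose r : seq int := [seq j%:Z | j <- iota 0 (size p)].
  have : (size r < size p)%N.
    apply: max_poly_roots => //; last by rewrite map_inj_uniq ?iota_uniq // => ? ? [].
    apply/allP => x _; apply/rootP/eqP/negPn/negP => px; apply: nex; by exists x.
  by rewrite size_map size_iota ltnn.
exists (fun l => (rVpoly l).[t]); split=> [l m|l m ls ms fE].
  by rewrite linearD hornerD.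
apply/eqP; rewrite -subr_eq0; apply: contraNT pt => lm.
have Dlm : l - m \in D by apply/allpairsP; exists (l, m).
rewrite /p horner_prod prodf_seq_eq0; apply/hasP; exists (l - m) => //=.
by rewrite lm linearB hornerD hornerN /= fE subrr.
Qed.

Section TorusBasis.

Variables (k : fieldType) (A : algType k) (n : nat).
Variables (U : 'rV[int]_n -> A) (c : 'rV[int]_n -> 'rV[int]_n -> k).

(** The torus as a twisted group algebra of Z^n. The basis is not normalised: [U 0] is only a scalar
    multiple of 1. In [tb_span] coefficients form a total function, so that two elements can be
    compared on a common list of degrees. *)
Record torus_basis : Prop := TorusBasis {
  tb_span : forall x, exists s : seq 'rV[int]_n * ('rV[int]_n -> k),
    [/\ uniq s.1, forall l, l \notin s.1 -> s.2 l = 0 & x = \sum_(l <- s.1) s.2 l *: U l];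
  tb_free : forall (s : seq 'rV[int]_n) a, uniq s ->
    \sum_(l <- s) a l *: U l = 0 -> forall l, l \in s -> a l = 0;
  tb_mul : forall l m, U l * U m = c l m *: U (l + m);
  tb_neq0 : forall l m, c l m != 0
}.

Hypothesis tb : torus_basis.

(** An arbitrary choice of expansion, whose list may contain degrees with coefficient zero. Only the
    coefficients are canonical, by [tcoef_unique]. *)
Definition torus_rep x := constructive_indefinite_description _ (tb_span tb x).
Definition tsupp x : seq 'rV[int]_n := (sval (torus_rep x)).1.
Definition tcoef x : 'rV[int]_n -> k := (sval (torus_rep x)).2.

Lemma tsupp_uniq x : uniq (tsupp x).
Proof. by rewrite /tsupp; case: torus_rep => ? []. Qed.

Lemma tcoef_out x l : l \notin tsupp x -> tcoef x l = 0.
Proof. by case: (svalP (torus_rep x)) => _ H _; apply: H. Qed.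

Lemma tcoef_sum x : x = \sum_(l <- tsupp x) tcoef x l *: U l.
Proof. by case: (svalP (torus_rep x)). Qed.

Definition tlift (B : lmodType k) (V : 'rV[int]_n -> B) (x : A) : B :=
  \sum_(l <- tsupp x) tcoef x l *: V l.

Lemma tlift_wide (B : lmodType k) (V : 'rV[int]_n -> B) x s :
  uniq s -> {subset tsupp x <= s} -> tlift V x = \sum_(l <- s) tcoef x l *: V l.
Proof.
move=> us sub; apply: big_uniq_supp => // [|l|l lns]; first exact: tsupp_uniq.
  by move=> /tcoef_out->; rewrite scale0r.
by rewrite tcoef_out ?scale0r //; apply: contra lns; apply: sub.
Qed.

Lemma tcoef_wide x s : uniq s -> {subset tsupp x <= s} -> x = \sum_(l <- s) tcoef x l *: U l.
Proof. by move=> us sub; rewrite -tlift_wide // {1}[x]tcoef_sum. Qed.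

Lemma tcoef_unique x s a : uniq s -> (forall l, l \notin s -> a l = 0) ->
  x = \sum_(l <- s) a l *: U l -> tcoef x =1 a.
Proof.
move=> us as0 xE l; set t := undup (l :: s ++ tsupp x).
have ut : uniq t := undup_uniq _.
have xt : x = \sum_(l <- t) tcoef x l *: U l.
  by apply: tcoef_wide => // m mx; rewrite mem_undup inE mem_cat mx !orbT.
have at_ : x = \sum_(l <- t) a l *: U l.
  rewrite xE; apply: big_uniq_supp => // m; first by move=> /as0->; rewrite scale0r.
  rewrite mem_undup inE mem_cat !negb_or => /and3P[_ ms _].
  by rewrite as0 // scale0r.
have /(_ t _ ut) := tb_free tb; move/(_ (fun l => tcoef x l - a l)).
under eq_bigr do rewrite scalerBl; rewrite sumrB -xt -at_ subrr => /(_ erefl l).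
by rewrite mem_undup mem_head => /(_ isT) /eqP; rewrite subr_eq0 => /eqP.
Qed.

Lemma tcoef_linear a x y : tcoef (a *: x + y) =1 (fun l => a * tcoef x l + tcoef y l).
Proof.
have us := undup_uniq (tsupp x ++ tsupp y).
apply: (tcoef_unique us) => [l|].
  by rewrite mem_undup mem_cat negb_or => /andP[lx ly]; rewrite !tcoef_out // mulr0 addr0.
under eq_bigr do rewrite scalerDl -scalerA.
by rewrite big_split -scaler_sumr -!tcoef_wide // => l ll; rewrite mem_undup mem_cat ll ?orbT.
Qed.

Lemma tcoefU l m : tcoef (U l) m = (m == l)%:R.
Proof.
apply: (@tcoef_unique _ [:: l] (fun m => (m == l)%:R)) => //.
  by move=> p; rewrite inE => /negPf->.
by rewrite big_seq1 eqxx scale1r.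
Qed.

Lemma tcoef_inj x y : tcoef x =1 tcoef y -> x = y.
Proof.
move=> xy; have us := undup_uniq (tsupp x ++ tsupp y).
rewrite (tcoef_wide us (x := x)) => [|l ll]; last by rewrite mem_undup mem_cat ll.
rewrite [RHS](tcoef_wide us) => [|l ll]; last by rewrite mem_undup mem_cat ll orbT.
by apply: eq_bigr => l _; rewrite xy.
Qed.

Lemma tcoef0 l : tcoef 0 l = 0.
Proof.
by have := tcoef_linear (-1) 0 0 l; rewrite scaler0 addr0 mulN1r addNr.
Qed.

Lemma tcoef_sumE (I : Type) (r : seq I) (P : pred I) (F : I -> A) l :
  tcoef (\sum_(i <- r | P i) F i) l = \sum_(i <- r | P i) tcoef (F i) l.
Proof.
apply: (big_morph (fun x => tcoef x l)) => [x y|]; last exact: tcoef0.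
by have := tcoef_linear 1 x y l; rewrite scale1r mul1r.
Qed.

Lemma tcoefZ a x l : tcoef (a *: x) l = a * tcoef x l.
Proof. by have := tcoef_linear a x 0 l; rewrite tcoef0 !addr0. Qed.

Lemma tlift_linear (B : lmodType k) (V : 'rV[int]_n -> B) : linear (tlift V).
Proof.
move=> a x y; pose s := undup (tsupp (a *: x + y) ++ tsupp x ++ tsupp y).
have us : uniq s := undup_uniq _.
rewrite !(tlift_wide _ us) => [|l|l|l]; try by rewrite mem_undup !mem_cat => ->; rewrite ?orbT.
rewrite scaler_sumr -big_split; apply: eq_bigr => l _.
by rewrite tcoef_linear scalerDl scalerA.
Qed.

Lemma tliftU (B : lmodType k) (V : 'rV[int]_n -> B) l : tlift V (U l) = V l.
Proof.
have us := undup_uniq (l :: tsupp (U l)).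
rewrite (tlift_wide _ us) => [|m mm]; last by rewrite mem_undup inE mm orbT.
rewrite (bigD1_seq l) ?mem_undup ?mem_head ?us // tcoefU eqxx scale1r.
by rewrite big1 /= ?addr0 // => m /negPf ml; rewrite tcoefU ml scale0r.
Qed.

HB.instance Definition _ (B : lmodType k) (V : 'rV[int]_n -> B) :=
  GRing.isLinear.Build k A B _ (tlift V) (tlift_linear V).

Lemma torus_linear_ext (B : lmodType k) (f g : A -> B) : linear f -> linear g ->
  (forall l, f (U l) = g (U l)) -> f =1 g.
Proof.
move=> fL gL fg x.
have f0 : f 0 = 0 by have := fL (-1) 0 0; rewrite !scaleN1r !addNr.
have g0 : g 0 = 0 by have := gL (-1) 0 0; rewrite !scaleN1r !addNr.
by rewrite [x]tcoef_sum; elim/big_rec: _ => [|l y _ IH]; rewrite ?f0 ?g0 // fL gL IH fg.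
Qed.

Lemma torus_mulE x y : x * y =
  \sum_(l <- tsupp x) \sum_(m <- tsupp y) (tcoef x l * tcoef y m * c l m) *: U (l + m).
Proof.
rewrite {1}[x]tcoef_sum {1}[y]tcoef_sum big_distrlr /=.
apply: eq_bigr => l _; apply: eq_bigr => m _.
by rewrite -scalerAl -scalerAr (tb_mul tb) !scalerA.
Qed.

Lemma tU_neq0 l : U l != 0.
Proof. by apply: contra_eq_neq (tcoefU l l) => ->; rewrite tcoef0 eqxx eq_sym oner_eq0. Qed.

Lemma tU_scaleI l a b : a *: U l = b *: U l -> a = b.
Proof. by move/(congr1 (fun x => tcoef x l)); rewrite !tcoefZ tcoefU eqxx !mulr1. Qed.

Lemma torus_cocycle l m p : c l m * c (l + m) p = c m p * c l (m + p).
Proof.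
apply: (@tU_scaleI (l + m + p)).
rewrite -scalerA -(tb_mul tb) scalerAl -(tb_mul tb) -scalerA -[in RHS]addrA -(tb_mul tb).
by rewrite scalerAr -(tb_mul tb) mulrA.
Qed.

Definition tcomm l m := c l m / c m l.

Lemma tcomm_mul l m : U l * U m = tcomm l m *: (U m * U l).
Proof. by rewrite !(tb_mul tb) scalerA divfK ?(tb_neq0 tb) // addrC. Qed.

Lemma tcommC l m : tcomm l m * tcomm m l = 1.
Proof. by rewrite /tcomm mulrA divfK ?divff ?(tb_neq0 tb). Qed.

Lemma tcommxx l : tcomm l l = 1.
Proof. by rewrite /tcomm divff ?(tb_neq0 tb). Qed.

Lemma tcomm_neq0 l m : tcomm l m != 0.
Proof. by rewrite mulf_neq0 ?invr_eq0 ?(tb_neq0 tb). Qed.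

Lemma tcommDl l l' m : tcomm (l + l') m = tcomm l m * tcomm l' m.
Proof.
have nz := tb_neq0 tb.
apply: (@tU_scaleI (l + l' + m)).
have H : U l * U l' * U m = (tcomm l m * tcomm l' m) *: (U m * U l * U l').
  by rewrite -mulrA tcomm_mul -scalerAr mulrA [U l * U m]tcomm_mul -scalerAl scalerA mulrC.
rewrite -[_ * U l * U l']mulrA (tb_mul tb l l') -scalerAl -scalerAr scalerA mulrC -scalerA in H.
move/(scalerI (nz l l')): H; rewrite tcomm_mul !(tb_mul tb) !scalerA [m + _]addrC => /tU_scaleI.
by move/(mulIf (nz _ _)) ->.
Qed.

Lemma tcommDr l m m' : tcomm l (m + m') = tcomm l m * tcomm l m'.
Proof.
apply: (mulIf (tcomm_neq0 (m + m') l)); rewrite tcommC tcommDl mulrACA.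
by rewrite !tcommC mulr1.
Qed.

Lemma tcommMn l m j : tcomm (l *+ j) m = tcomm l m ^+ j.
Proof.
elim: j => [|j IH]; last by rewrite mulrS tcommDl exprS IH.
by apply: (mulIf (tcomm_neq0 0 m)); rewrite -tcommDl addr0 mul1r.
Qed.

Lemma tcoef_mulUr x l m : tcoef (x * U m) (l + m) = tcoef x l * c l m.
Proof.
apply: (torus_linear_ext (B := k^o) (f := fun x => tcoef (x * U m) (l + m))
  (g := fun x => tcoef x l * c l m)) => [a y y'|a y y'|p].
- by rewrite mulrDl -scalerAl tcoef_linear.
- by rewrite tcoef_linear mulrDl -mulrA.
rewrite (tb_mul tb) tcoefZ !tcoefU (inj_eq (addIr m)) mulrC.
by case: eqP => [->|]; rewrite ?mul0r.
Qed.

Lemma tcoef_mulUl x l m : tcoef (U m * x) (m + l) = tcoef x l * c m l.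
Proof.
apply: (torus_linear_ext (B := k^o) (f := fun x => tcoef (U m * x) (m + l))
  (g := fun x => tcoef x l * c m l)) => [a y y'|a y y'|p].
- by rewrite mulrDr -scalerAr tcoef_linear.
- by rewrite tcoef_linear mulrDl -mulrA.
rewrite (tb_mul tb) tcoefZ !tcoefU (inj_eq (addrI m)) mulrC.
by case: eqP => [->|]; rewrite ?mul0r.
Qed.

(** Comparing the coefficients of z U_m = U_m z in degree l + m puts every degree that occurs in a
    central element into the radical of the bicharacter [tcomm]. *)
Lemma torus_central_supp z l m : (forall y, z * y = y * z) -> tcoef z l != 0 ->
  tcomm l m = 1.
Proof.
move=> zC zl; have := tcoef_mulUr z l m; rewrite zC addrC tcoef_mulUl => /(mulfI zl) e.
by rewrite /tcomm e divff ?(tb_neq0 tb).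
Qed.

(** Central coefficients contribute only radical degrees, so the finitely many degrees [T] of the
    module generators represent all of Z^n modulo the radical of [tcomm]. The radical has finite
    index, which bounds the orders of the values. *)
Lemma fgc_tcomm_finite : assoc_fgc A ->
  exists2 M, (0 < M)%N & forall l m, tcomm l m ^+ M = 1.
Proof.
move=> [s Hs]; pose T := flatten (map tsupp s).
have HT l : exists i : 'I_(size T), forall m, tcomm (l - nth 0 T i) m = 1.
  have [zs [zC Ul]] := Hs (U l).
  have : tcoef (U l) l != 0 by rewrite tcoefU eqxx oner_eq0.
  rewrite {1}Ul tcoef_sumE => H.
  have [i Hi] : exists i : 'I_(size s), tcoef (zs i * nth 0 s i) l != 0.
    apply: NNPP => nex; case/negP: H; rewrite big1 // => i _.
    by apply/eqP/negPn/negP => H; apply: nex; exists i.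
  rewrite torus_mulE tcoef_sumE in Hi.
  have [p Hp] : exists p, \sum_(m <- tsupp (nth 0 s i)) 
      tcoef (tcoef (zs i) p * tcoef (nth 0 s i) m * c p m *: U (p + m)) l != 0.
    apply: NNPP => nex; case/negP: Hi; rewrite big1 // => p _.
    by rewrite tcoef_sumE; apply/eqP/negPn/negP => H'; apply: nex; exists p.
  have [m mT Hm] : exists2 m, m \in tsupp (nth 0 s i) & 
      tcoef (tcoef (zs i) p * tcoef (nth 0 s i) m * c p m *: U (p + m)) l != 0.
    apply: NNPP => nex; case/negP: Hp; rewrite big_seq big1 // => m mT.
    by apply/eqP/negPn/negP => H'; apply: nex; exists m.
  move: Hm; rewrite tcoefZ tcoefU mulf_eq0 negb_or => /andP[].
  rewrite !mulf_eq0 !negb_or => /andP[/andP[zp _] _].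
  case: (l =P p + m) => [lE _|_]; last by rewrite eqxx.
  have mT' : m \in T.
    by apply/flattenP; exists (tsupp (nth 0 s i)) => //; apply/map_f/mem_nth.
  have iT : (index m T < size T)%N by rewrite index_mem.
  exists (Ordinal iT) => q; rewrite /= nth_index // lE addrK; exact: torus_central_supp (zC i) zp.
(* Among the multiples of [l] by 0, ..., [size T], two agree modulo the radical; the difference of
   their indices is at most [size T] and so divides the factorial. *)
exists ((size T)`!)%N; first exact: fact_gt0.
move=> l m.
have [f fP] := functional_choice _ (fun j : 'I_(size T).+1 => HT (l *+ j)).
have /injectivePn [i [j ij fij]] : ~~ injectiveb f.
  apply/negP => /injectiveP finj.
  by have := leq_card f finj; rewrite !card_ord ltnn.
wlog lt_ij : i j ij fij / (i < j)%N.
  move=> W; case: (ltngtP i j) => [||e]; [exact: W|by apply: W; rewrite // eq_sym|].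
  by move/eqP: ij; case; apply: val_inj.
have e1 : tcomm l m ^+ (j - i) = 1.
  rewrite -tcommMn mulrnBr ?(ltnW lt_ij) //.
  apply: (mulIf (tcomm_neq0 (l *+ i - nth 0 T (f i)) m)).
  by rewrite -tcommDl addrA subrK {1}fij !fP mulr1.
have /dvdnP[q ->] : (j - i %| (size T)`!)%N.
  by apply: dvdn_fact; rewrite subn_gt0 lt_ij /= leq_subLR; apply: leq_trans (leq_addl _ _); rewrite -ltnS.
by rewrite mulnC exprM e1 expr1n.
Qed.

Lemma torus1 : 1 = (c 0 0)^-1 *: U 0.
Proof.
have cc l : c 0 l = c 0 0.
  have := torus_cocycle 0 0 l; rewrite !add0r => H.
  by apply/esym/(mulIf (tb_neq0 tb 0 l)).
rewrite -[LHS](mul1r 1) -[RHS]mulr1.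
apply: (torus_linear_ext (f := fun x => 1 * x) (g := fun x => (c 0 0)^-1 *: U 0 * x)).
- by move=> a x y; rewrite !mul1r.
- by move=> a x y; rewrite mulrDr scalerAr.
move=> l; rewrite mul1r -scalerAl (tb_mul tb) add0r scalerA cc mulVf ?scale1r //.
exact: tb_neq0 tb _ _.
Qed.

Lemma tU_inv l : exists a : k, U l * (a *: U (- l)) = 1 /\ (a *: U (- l)) * U l = 1.
Proof.
have inv m : U m * (((c m (- m))^-1 * (c 0 0)^-1) *: U (- m)) = 1.
  rewrite -scalerAr (tb_mul tb) subrr [_^-1 * _]mulrC scalerA mulfVK ?(tb_neq0 tb) //.
  by rewrite -torus1.
have := inv (- l); rewrite opprK; set b : k := _ / _ => Vb.
have := inv l; set a : k := _ / _ => aV; exists a; split=> //.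
have a0 : a != 0 by apply: contra_eq_neq aV => ->; rewrite scale0r mulr0 eq_sym oner_eq0.
have Vab : (a *: U (- l)) * ((a^-1 * b) *: U l) = 1.
  by rewrite -scalerAl -scalerAr scalerA mulrA mulfV // mul1r scalerAr.
have := congr1 (fun x => U l * x) Vab; rewrite mulrA aV mul1r mulr1 => e.
by rewrite -[X in _ * X]e.
Qed.

Lemma tU_domain (x y : A) : x * y = 0 -> x = 0 \/ y = 0.
Proof.
move=> xy; have [->|x0] := eqVneq x 0; [by left|right]; apply: contra_eq (xy) => y0.
have [f [fD finj]] := int_form_separates (tsupp x ++ tsupp y).
have maxi z : z != 0 -> exists l, [/\ l \in tsupp z, tcoef z l != 0 &
    forall m, tcoef z m != 0 -> f m <= f l].
  move=> z0; have : [seq l <- tsupp z | tcoef z l != 0] != [::].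
    rewrite -has_filter; apply: contraNT z0 => /hasPn z0; apply/eqP/tcoef_inj => l.
    rewrite tcoef0; case: (boolP (l \in tsupp z)) => [/z0|/tcoef_out->//].
    by rewrite negbK => /eqP.
  move=> /(seq_max f)[l]; rewrite mem_filter => /andP[zl ls] lmax.
  exists l; split=> // m zm; apply: lmax; rewrite mem_filter zm.
  by apply: contraNT zm => /tcoef_out->.
have [l [ls xl lmax]] := maxi x x0; have [m [ms ym mmax]] := maxi y y0.
have : tcoef (x * y) (l + m) != 0.
  rewrite torus_mulE tcoef_sumE (bigD1_seq l) ?tsupp_uniq //=.
  rewrite tcoef_sumE (bigD1_seq m) ?tsupp_uniq //= tcoefZ tcoefU eqxx mulr1.
  (* Another pair with nonzero coefficients and sum l + m would have to attain both maxima of [f],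
     which is injective on the supports. *)
  have zero p q : (p, q) != (l, m) -> p \in tsupp x -> q \in tsupp y ->
      tcoef ((tcoef x p * tcoef y q * c p q) *: U (p + q)) (l + m) = 0.
    move=> pq ps qs; rewrite tcoefZ tcoefU.
    case: eqP => [e|]; last by rewrite mulr0.
    apply/eqP; rewrite mulr1 !mulf_eq0 -orbA.
    have [//|xp /=] := boolP (tcoef x p == 0); have [//|yq /=] := boolP (tcoef y q == 0).
    have fe : f l + f m = f p + f q by rewrite -!fD e.
    have [fp fq] := (lmax p xp, mmax q yq).
    have fpl : f p = f l.
      by apply/eqP; rewrite eq_le fp /= -(lerD2r (f m)) fe lerD2l.
    have fqm : f q = f m by move: fe; rewrite fpl => /addrI.
    by case/eqP: pq; congr pair; apply: finj; rewrite ?mem_cat ?ps ?qs ?ls ?ms ?orbT.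
  rewrite big_seq_cond big1 => [|q /andP[qs qm]]; last first.
    by apply: zero => //; apply: contra qm => /eqP[->].
  rewrite addr0 big_seq_cond big1 => [|p /andP[ps pl]]; last first.
    rewrite tcoef_sumE big_seq big1 // => q qs.
    by apply: zero => //; apply: contra pl => /eqP[->].
  by rewrite addr0 !mulf_neq0 // (tb_neq0 tb).
by rewrite xy tcoef0 eqxx.
Qed.

End TorusBasis.

(* If [b] is the commutation bicharacter and [g] satisfies [b (g l) (g m) = b m l], the cocycles of [U] and of the reversed product on [U \o g] differ by a symmetric cocycle, which splits. *)
Lemma torus_antiautomorphism (k : closedFieldType) (A : algType k) n U c :
  [pchar k] =i pred0 -> @torus_basis k A n U c -> assoc_fgc A ->
  exists t : {linear A -> A}, bijective t /\ forall x y, t (x * y) = t y * t x.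
Proof.
move=> chk tb fgc; have [M M0 bM] := fgc_tcomm_finite tb fgc.
have [z zM] := closed_prim_root chk M0.
have [B skB bE] := bichar_log zM (tcommDl tb) (tcommDr tb) (tcommC tb) (tcommxx tb) bM.
have [g gu Bg] := skew_mx_negatable skB.
pose G (l : 'rV[int]_n) := l *m g^T; pose G' (l : 'rV[int]_n) := l *m (invmx g)^T.
have GK : cancel G G' by move=> l; rewrite /G /G' -mulmxA -trmx_mul mulVmx // trmx1 mulmx1.
have G'K : cancel G' G by move=> l; rewrite /G /G' -mulmxA -trmx_mul mulmxV // trmx1 mulmx1.
have GD l m : G (l + m) = G l + G m by rewrite /G mulmxDl.
have nz := tb_neq0 tb.
(* The exponent of [z] at (G m, G l) is m g^T B g l^T = - m B l^T, which is the exponent at (l, m)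
   by skewness. *)
have bG l m : tcomm c (G m) (G l) = tcomm c l m.
  apply: (mulIf (tcomm_neq0 tb m l)); rewrite (tcommC tb) !bE /G trmx_mul trmxK.
  have -> : m *m g^T *m B *m (g *m l^T) = - (m *m B *m l^T).
    by rewrite -mulNmx -mulmxN -Bg !mulmxA.
  have z0 : z != 0 by rewrite (prim_root_eq0 zM) -lt0n.
  by rewrite -expfzDr // !mxE addNr.
pose c' l m := c (G m) (G l) / c l m.
have c'P : symmetric_cocycle c'.
  split=> [l m|l m|l m p]; first by rewrite mulf_neq0 ?invr_eq0.
    have := bG l m; rewrite /tcomm /c' => /(canRL (divfK (nz _ _))) ->.
    by rewrite mulrAC [X in X * _ = _]mulrAC divff // mul1r mulrC.
  rewrite /c' mulrACA -invfM [c l m * _](torus_cocycle tb) mulrACA -invfM; congr (_ / _).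
  by rewrite !GD [G m + G p]addrC (torus_cocycle tb) [G m + G l]addrC.
have [d [d0 dD]] := symmetric_cocycle_split c'P.
(* The intended image of [U l]. The scalars [d] absorb [c'], so the [V l] multiply in reversed order
   with the original constants [c]. *)
pose V l := d l *: U (G l).
pose V' l := (d (G' l))^-1 *: U (G' l).
have VM l m : V m * V l = c l m *: V (l + m).
  rewrite /V -scalerAl -scalerAr (tb_mul tb) !scalerA -dD GD [G m + _]addrC; congr (_ *: _).
  by rewrite /c' [RHS]mulrCA [c l m * _]mulrC divfK // [d l * _]mulrC.
exists (tlift tb V); split.
  exists (tlift tb V') => x.
    apply: (torus_linear_ext tb (f := tlift tb V' \o tlift tb V) (g := id)) => //.
      exact: linearP.
    by move=> l; rewrite /= tliftU linearZ /= tliftU /V' GK scalerA mulfV // scale1r.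
  apply: (torus_linear_ext tb (f := tlift tb V \o tlift tb V') (g := id)) => //.
    exact: linearP.
  by move=> l; rewrite /= tliftU linearZ /= tliftU /V G'K scalerA mulVf // scale1r.
move=> x y; move: x.
apply: (torus_linear_ext tb (f := fun x => tlift tb V (x * y)) (g := fun x => tlift tb V y * tlift tb V x)).
- by move=> a u v; rewrite mulrDl -scalerAl linearP.
- by move=> a u v; rewrite linearP mulrDr -scalerAr.
move=> l; move: y.
apply: (torus_linear_ext tb (f := fun y => tlift tb V (U l * y)) (g := fun y => tlift tb V y * tlift tb V (U l))).
- by move=> a u v; rewrite mulrDr -scalerAr linearP.
- by move=> a u v; rewrite linearP mulrDl -scalerAl.
by move=> m; rewrite (tb_mul tb) linearZ /= !tliftU VM.
Qed.

Lemma assoc_torus_basis (k : fieldType) (A : algType k) n :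
  assoc_torus A n -> exists U c, @torus_basis k A n U c.
Proof.
move=> [Gr [Gsub Gspan Gfree Gmul Gu]].
have [U HU] := functional_choice _ Gu.
have GU l : Gr l (U l) by apply/(HU l).2; exists 1; rewrite scale1r.
have U0 l : U l != 0.
  have [[v [uv _]] _] := HU l.
  by apply: contra_eq_neq uv => ->; rewrite mul0r eq_sym oner_eq0.
have UM l m : exists c, U l * U m = c *: U (l + m) by apply/(HU _).2; exact: Gmul.
have [c cE] := functional_choice _ (fun p : 'rV[int]_n * 'rV[int]_n => UM p.1 p.2).
exists U, (fun l m => c (l, m)); split.
- move=> x; have [s [sG ->]] := Gspan x.
  (* The given list of homogeneous summands may repeat a degree, so the coefficients are accumulated
     one summand at a time. *)
  elim: s sG => [|[l y] s IH] sG; first by exists ([::], fun=> 0); rewrite !big_nil; split.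
  have [|[t a] /= [ut ta tE]] := IH; first by move=> u us; apply: sG; rewrite inE us orbT.
  have [b /= yE] := ((HU l).2 y).1 (sG (l, y) (mem_head _ _)).
  have [w uw wE] : exists2 w, uniq w & w =i l :: t.
    by exists (undup (l :: t)); [exact: undup_uniq|exact: mem_undup].
  exists (w, fun m => (m == l)%:R * b + a m); split=> //=.
    by move=> m; rewrite wE inE negb_or => /andP[/negPf-> /ta->]; rewrite mul0r add0r.
  rewrite big_cons; under [RHS]eq_bigr do rewrite scalerDl.
  rewrite [RHS]big_split /=; congr (_ + _).
    rewrite (bigD1_seq l) ?wE ?mem_head //= eqxx mul1r big1 ?addr0 //.
    by move=> m /negPf->; rewrite mul0r scale0r.
  rewrite tE; apply: big_uniq_supp => // m; first by move=> /ta->; rewrite scale0r.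
  by rewrite wE inE negb_or => /andP[_ /ta->]; rewrite scale0r.
- move=> s a us sum0 l ls.
  pose w := [seq (l, a l *: U l) | l <- s].
  have uw : uniq (map fst w) by rewrite -map_comp map_id_in.
  have wG u : u \in w -> Gr u.1 u.2.
    by move=> /mapP[m _ ->]; apply/(HU m).2; exists (a m).
  have w0 : \sum_(u <- w) u.2 = 0 by rewrite big_map.
  have /eqP := Gfree w uw wG w0 _ (map_f (fun l => (l, a l *: U l)) ls).
  by rewrite scaler_eq0 (negPf (U0 l)) orbF => /eqP.
- by move=> l m; exact: (cE (l, m)).
move=> l m; apply/eqP => c0.
have := cE (l, m); rewrite /= c0 scale0r => e.
have [[v [_ vu]] _] := HU l.
by have /eqP := U0 m; apply; rewrite -[U m]mul1r -vu -mulrA e mulr0.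
Qed.

(** * Jordan homomorphisms *)

(** A group is not the union of two proper subgroups: for x in P and y outside P, both y and y + x
    lie in Q, hence so does x. *)
Lemma subgroup_cover2 (V : zmodType) (P Q : V -> Prop) :
  (forall x y, P x -> P (y + x) -> P y) -> (forall x y, Q x -> Q (x + y) -> Q y) ->
  (forall x, P x \/ Q x) -> (forall x, P x) \/ (forall x, Q x).
Proof.
move=> PB QB PQ; have [|nP] := classic (forall x, P x); [by left|right=> x].
have [y Py] : exists y, ~ P y by apply: NNPP => H; apply: nP => y; apply: NNPP => Py; apply: H; exists y.
have Qy : Q y by case: (PQ y).
case: (PQ x) => // Px; case: (PQ (y + x)) => [|/(QB _ _ Qy)//].
by move/(PB _ _ Px).
Qed.

Section JordanTriple.

Variables (A A' : nzRingType).
Hypothesis domA' : forall x y : A', x * y = 0 -> x = 0 \/ y = 0.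
Hypothesis char2 : forall x : A', x + x = 0 -> x = 0.

Let half (x y : A') : x + x = y + y -> x = y.
Proof.
by move=> e; apply/eqP; rewrite -subr_eq0; apply/eqP/char2; rewrite addrACA e -opprD subrr.
Qed.

(** The product (f(ab) - f(a)f(b)) (f(ab) - f(b)f(a)) vanishes, so in a domain each pair (a, b)
    satisfies one of the two rules. The choice becomes uniform by covering the group of all b with
    two subgroups for fixed a, and then the group of all a. *)
Lemma jordan_hom_or_antihom (f : A -> A') :
  {morph f : x y / x + y} -> f 1 = 1 ->
  (forall x y z, f (x * y * z + z * y * x) = f x * f y * f z + f z * f y * f x) ->
  (forall x y, f (x * y) = f x * f y) \/ (forall x y, f (x * y) = f y * f x).
Proof.
move=> fD f1 fT.
have fxyx x y : f (x * y * x) = f x * f y * f x by apply: half; rewrite -fD fT.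
have fxx x : f (x * x) = f x * f x by have := fxyx x 1; rewrite f1 !mulr1.
have key a b : f (a * b) = f a * f b \/ f (a * b) = f b * f a.
  have : (f (a * b) - f a * f b) * (f (a * b) - f b * f a) = 0.
    have e1 := fxx (a * b).
    have e2 : f (a * (b * b) * a) = f a * (f b * f b) * f a by rewrite fxyx fxx.
    (* With third argument ab the triple identity computes f(abab) + f(abba), exactly the sum of
       [e1] and [e2]; this cancels the expanded product. *)
    have e3 := fT a b (a * b); rewrite fD !mulrA in e3 e1 e2.
    rewrite mulrBl !mulrBr !mulrA opprB addrACA -e1 -e2 e3 -opprD.
    by rewrite [_ * f a + _]addrC subrr.
  by case/domA' => /eqP; rewrite subr_eq0 => /eqP; [left|right].
have Hm a : (forall b, f (a * b) = f a * f b) \/ (forall b, f (a * b) = f b * f a).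
  apply: subgroup_cover2 => [x y Px|x y Qx|//].
    by rewrite mulrDr !fD Px mulrDr => /addIr.
  by rewrite mulrDr !fD Qx mulrDl => /addrI.
apply: subgroup_cover2 => [x y Px + b|x y Qx + b|//].
  by move/(_ b); rewrite mulrDl !fD Px mulrDl => /addIr.
by move/(_ b); rewrite mulrDl !fD Qx mulrDr => /addrI.
Qed.

(* [f 1] is invertible with inverse [g 1], and [f * g 1] is a unital Jordan homomorphism. *)
Lemma jordan_pair_unital (f g : A -> A') :
  {morph f : x y / x + y} -> injective f ->
  (forall x y z, f (x * y * z + z * y * x) = f x * g y * f z + f z * g y * f x) ->
  exists u v : A', [/\ u * v = 1, v * u = 1 &
    (forall x y, f (x * y) * v = (f x * v) * (f y * v)) \/
    (forall x y, f (x * y) * v = (f y * v) * (f x * v))].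
Proof.
move=> fD finj fT; exists (f 1), (g 1).
have f0 : f 0 = 0 by apply: (addrI (f 0)); rewrite -fD !addr0.
have fg y : f y = f 1 * g y * f 1.
  by apply: half; rewrite -fT mul1r mulr1 fD.
have u0 : f 1 <> 0 by rewrite -f0 => /finj/eqP; rewrite oner_eq0.
have uv : f 1 * g 1 = 1.
  have : (f 1 * g 1 - 1) * f 1 = 0 by rewrite mulrBl -fg mul1r subrr.
  by case/domA' => // /eqP; rewrite subr_eq0 => /eqP.
have vu : g 1 * f 1 = 1.
  have : f 1 * (g 1 * f 1 - 1) = 0 by rewrite mulrBr mulrA -fg mulr1 subrr.
  by case/domA' => // /eqP; rewrite subr_eq0 => /eqP.
split=> //; apply: (@jordan_hom_or_antihom (fun x => f x * g 1)) => // [x y|x y z].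
  by rewrite fD mulrDl.
have gf : g y = g 1 * f y * g 1 by rewrite (fg y) !mulrA vu mul1r -mulrA uv mulr1.
by rewrite fT gf mulrDl !mulrA.
Qed.

End JordanTriple.

Lemma alg_isomorphic_of_bijective (k : fieldType) (A A' : algType k) (f : A -> A') :
  linear f -> bijective f -> (forall x y, f (x * y) = f x * f y) -> alg_isomorphic A A'.
Proof.
move=> fL [g fK gK] fM.
have f1 : f 1 = 1 by rewrite -[LHS]mulr1 -[X in _ * X]gK -fM mul1r gK.
pose lm := GRing.isLinear.Build k A A' _ f fL.
pose mm := GRing.isMonoidMorphism.Build A A' f (f1, fM).
pose F : {lrmorphism A -> A'} := HB.pack f lm mm.
by exists F; exists g.
Qed.

Lemma jordan_pair_alg_isomorphic (k : fieldType) (A A' : algType k) (f g : A -> A')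
    (t : {linear A' -> A'}) :
  (2 : k) != 0 -> (forall x y : A', x * y = 0 -> x = 0 \/ y = 0) ->
  bijective t -> (forall x y, t (x * y) = t y * t x) ->
  linear f -> bijective f ->
  (forall x y z, f (x * y * z + z * y * x) = f x * g y * f z + f z * g y * f x) ->
  alg_isomorphic A A'.
Proof.
move=> two domA' tbij tM fL fbij fT.
have fD : {morph f : x y / x + y} by move=> x y; have := fL 1 x y; rewrite !scale1r.
have char2 (x : A') : x + x = 0 -> x = 0.
  by move=> /eqP; rewrite -mulr2n -scaler_nat scaler_eq0 (negPf two) => /eqP.
have [u [v [uv vu fM]]] := jordan_pair_unital domA' char2 fD (bij_inj fbij) fT.
pose h x := f x * v.
have hL : linear h by move=> a x y; rewrite /h fL mulrDl scalerAl.
have hbij : bijective h.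
  have [f' fK f'K] := fbij; exists (fun y => f' (y * u)) => x.
    by rewrite /h -mulrA vu mulr1 fK.
  by rewrite /h f'K -mulrA uv mulr1.
case: fM => hM; first exact: (alg_isomorphic_of_bijective hL hbij hM).
apply: (@alg_isomorphic_of_bijective _ _ _ (t \o h)); first 2 last.
- by move=> x y; rewrite /= {1}/h hM tM.
- by move=> a x y; rewrite /= hL linearP.
exact: bij_comp.
Qed.

(** * Roots of type A *)

Lemma uniq_map_inj_in (T T' : eqType) (f : T -> T') (s : seq T) :
  uniq (map f s) -> {in s &, injective f}.
Proof.
elim: s => //= x s IH /andP[fx us] y z; rewrite !inE.
case/predU1P=> [->|ys]; case/predU1P=> [->|zs] // fE; last exact: IH.
  by rewrite fE map_f in fx.
by rewrite -fE map_f in fx.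
Qed.

(* If [d] is the difference of two coroots, the product of the two reflections is [x |-> x + d x * a], which can preserve a finite set only if [d] vanishes on it. *)
Lemma is_coroot_unique m (D : seq 'rV[rat]_m) a c1 c2 : a != 0 ->
  is_coroot D a c1 -> is_coroot D a c2 -> {in D, c1 =1 c2}.
Proof.
move=> a0 [l1 a1 _ r1] [l2 a2 _ r2] b bD.
have l0 (c : 'rV[rat]_m -> rat) : (forall (e : rat) x y, c (e *: x + y) = e * c x + c y) ->
    forall e x, c (x - e *: a) = c x - e * c a.
  by move=> lc e x; rewrite addrC -scaleNr lc mulNr addrC.
pose d x := c2 x - c1 x.
have step x : x \in D -> x - d x *: a \in D.
  move=> xD; have := r2 _ (r1 _ xD); rewrite (l0 _ l2) a2 -addrA -opprD -scalerDl.
  suff -> : c1 x + (c2 x - c1 x * 2) = d x by [].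
  by rewrite /d; ring.
have da x : d (x - d x *: a) = d x.
  by rewrite /d (l0 _ l1) (l0 _ l2) a1 a2; ring.
have iter_in j : b - (j%:R * d b) *: a \in D /\ d (b - (j%:R * d b) *: a) = d b.
  elim: j => [|j [IH dE]]; first by rewrite mul0r scale0r subr0.
  have := step _ IH; have := da (b - (j%:R * d b) *: a).
  rewrite dE -addrA -opprD -scalerDl.
  by have -> : j%:R * d b + d b = j.+1%:R * d b by rewrite -addn1 natrD mulrDl mul1r.
apply/eqP; rewrite eq_sym -subr_eq0 -/(d b); apply/negPn/negP => db.
pose L := [seq b - (j%:R * d b) *: a | j <- iota 0 (size D).+1].
have : (size L <= size D)%N.
  apply: uniq_leq_size; last by move=> _ /mapP[j _ ->]; case: (iter_in j).
  rewrite map_inj_uniq ?iota_uniq // => i j /addrI/oppr_inj/eqP.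
  rewrite -subr_eq0 -scalerBl scaler_eq0 (negPf a0) orbF -mulrBl mulf_eq0 (negPf db) orbF.
  by rewrite subr_eq0 eqr_nat => /eqP.
by rewrite size_map size_iota ltnn.
Qed.

Section RootsA.

Variable r : nat.
Implicit Types (i j p q : 'I_r.+1) (x : 'rV[rat]_r).

(* The images of the standard basis vectors e_i of Q^(r+1) modulo the span of e_r; [hat] inverts this projection on vectors of coordinate sum zero. *)
Definition wt i : 'rV[rat]_r := \row_j (i == j :> nat)%:R.

Definition hat x i : rat := \sum_j x 0 j * ((i == j :> nat)%:R - (i == r :> nat)%:R).

Definition rootA i j := wt i - wt j.

Definition rootsA : seq 'rV[rat]_r := [seq rootA p.1 p.2 | p : 'I_r.+1 * 'I_r.+1].

Definition corootA i j x := hat x i - hat x j.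

Lemma hat_linear e x y i : hat (e *: x + y) i = e * hat x i + hat y i.
Proof.
by rewrite /hat mulr_sumr -big_split; apply: eq_bigr => j _; rewrite !mxE mulrDl mulrA.
Qed.

Lemma hat_wt i p : hat (wt i) p = (p == i)%:R - (p == r :> nat)%:R.
Proof.
rewrite /hat; have [ir|ri] := ltnP i r.
  rewrite (bigD1 (Ordinal ir)) //= big1 ?addr0 => [|j ij]; first by rewrite mxE eqxx mul1r.
  rewrite mxE; case: eqP => [e|_]; last by rewrite mul0r.
  by case/eqP: ij; apply: val_inj.
have ir : i = r :> nat by apply/eqP; rewrite eqn_leq ri -ltnS ltn_ord.
have -> : (p == i) = (p == r :> nat) by rewrite -val_eqE /= ir.
rewrite big1 => [|j _]; first by rewrite subrr.
by rewrite mxE ir gtn_eqF ?mul0r.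
Qed.

Lemma hat_root i j p : hat (rootA i j) p = (p == i)%:R - (p == j)%:R.
Proof.
by rewrite /rootA addrC -scaleN1r hat_linear !hat_wt; ring.
Qed.

(** [hat] recovers the coordinates of e_i - e_j, and their entries 1 and -1 locate [i] and [j]. *)
Lemma rootA_inj i j p q : i != j -> rootA i j = rootA p q -> i = p /\ j = q.
Proof.
move=> ij e; have := hat_root i j i; have := hat_root i j j; rewrite e !hat_root !eqxx.
rewrite (negPf ij) [j == i]eq_sym (negPf ij).
move=> /eqP + /eqP; case: (i =P p) => [<-|_]; case: (j =P q) => [<-|_] //;
  rewrite ?(negPf ij) ?[j == i]eq_sym ?(negPf ij) //;
  by case: (j == p); case: (i == q).
Qed.

Lemma rootA_eq0 i j : (rootA i j == 0) = (i == j).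
Proof.
apply/eqP/eqP => [e|->]; last exact: subrr.
apply/eqP/negPn/negP => ij; have := rootA_inj (p := i) (q := i) ij.
by rewrite e /rootA subrr => /(_ erefl)[_ ji]; rewrite ji eqxx in ij.
Qed.

Lemma rootAP a : reflect (exists i j, a = rootA i j) (a \in rootsA).
Proof.
apply: (iffP mapP) => [[[i j] _ ->]|[i [j ->]]]; first by exists i, j.
by exists (i, j); rewrite ?mem_enum.
Qed.

(** The Weyl group of type A is the symmetric group, and the reflection in e_i - e_j acts as the
    transposition (i j). This is why reflections preserve [rootsA]. *)
Lemma wt_tperm i j p :
  wt p - ((p == i)%:R - (p == j)%:R) *: rootA i j = wt (tperm i j p).
Proof.
rewrite /rootA; case: tpermP => [->|->|/eqP/negPf-> /eqP/negPf->].
- rewrite eqxx; case: (i =P j) => [->|_]; first by rewrite !subrr scale0r subr0.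
  by rewrite subr0 scale1r subKr.
- rewrite eqxx; case: (j =P i) => [->|_]; first by rewrite !subrr scale0r subr0.
  by rewrite sub0r scaleN1r opprK addrC subrK.
by rewrite subrr scale0r subr0.
Qed.

Lemma corootAE i j p q : corootA i j (rootA p q) =
  (((p == i)%:R - (p == j)%:R) - ((q == i)%:R - (q == j)%:R) : int)%:~R.
Proof.
rewrite /corootA !hat_root ![_ == i]eq_sym ![_ == j]eq_sym !rmorphB /= !rmorph_nat.
by ring.
Qed.

Lemma rootA_coroot i j : i != j -> is_coroot rootsA (rootA i j) (corootA i j).
Proof.
move=> ij; split.
- by move=> e x y; rewrite /corootA !hat_linear; ring.
- by rewrite corootAE !eqxx [j == i]eq_sym (negPf ij).
- by move=> _ /rootAP[p [q ->]]; rewrite corootAE intr_int.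
move=> _ /rootAP[p [q ->]]; apply/rootAP; exists (tperm i j p), (tperm i j q).
rewrite corootAE -[RHS]/(wt _ - wt _) -!wt_tperm /rootA !rmorphB /= !rmorph_nat.
rewrite scalerBl opprB addrACA [in RHS]opprB [RHS]addrACA; congr (_ + _).
exact: addrC.
Qed.

Lemma root_system_rootsA : root_system0 rootsA.
Proof.
split.
- by apply/rootAP; exists ord_max, ord_max; rewrite /rootA subrr.
- apply/eqP; rewrite eqEsubv subvf; apply/subvP => x _; rewrite [x]row_sum_delta.
  apply: memv_suml => j _; apply/memvZ/memv_span/rootAP.
  (* [wt ord_max] is zero, so this root is the [j]-th unit vector. *)
  exists (widen_ord (leqnSn r) j), ord_max; apply/rowP => h; rewrite !mxE /=.
  by rewrite [r == h]gtn_eqF // subr0 eq_sym.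
move=> _ /rootAP[i [j ->]]; rewrite rootA_eq0 => ij.
by exists (corootA i j); apply: rootA_coroot.
Qed.

End RootsA.

(** * The Lie torus structure of sl *)

Lemma subspace_scale (k : fieldType) (V : zmodType) (sc : k -> V -> V) (P : V -> Prop) e x :
  subspace sc P -> P x -> P (sc e x).
Proof. by move=> [P0 PD] Px; rewrite -[sc e x]addr0; apply: PD. Qed.

Section MatrixLie.

Variables (k : fieldType) (A : algType k) (N : nat).
Implicit Types (X Y : 'M[A]_N) (i j p q : 'I_N) (x y : A) (e : k).

Local Notation br := (@mat_br k A N).
Local Notation sc := (@mat_sc k A N).
Local Notation sl := (@sl_set k A N).

Lemma mat_scE e X i j : sc e X i j = e *: X i j.
Proof. by rewrite mxE. Qed.

Lemma mat_scD e X Y : sc e (X + Y) = sc e X + sc e Y.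
Proof. by apply/matrixP => i j; rewrite !mxE scalerDr. Qed.

Lemma mat_sc_sum e (I : Type) (s : seq I) (F : I -> 'M[A]_N) :
  sc e (\sum_(i <- s) F i) = \sum_(i <- s) sc e (F i).
Proof.
apply: (big_morph _ (mat_scD e)); apply/matrixP => i j; rewrite !mxE; exact: scaler0.
Qed.

Lemma mat_sc1 X : sc 1 X = X.
Proof. by apply/matrixP => i j; rewrite !mxE scale1r. Qed.

Lemma mat_scA e f X : sc e (sc f X) = sc (e * f) X.
Proof. by apply/matrixP => i j; rewrite !mxE scalerA. Qed.

Lemma mat_sc_mulmxl e X Y : sc e X *m Y = sc e (X *m Y).
Proof.
by apply/matrixP => i j; rewrite !mxE scaler_sumr; apply: eq_bigr => p _; rewrite mxE scalerAl.
Qed.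

Lemma mat_sc_mulmxr e X Y : X *m sc e Y = sc e (X *m Y).
Proof.
by apply/matrixP => i j; rewrite !mxE scaler_sumr; apply: eq_bigr => p _; rewrite mxE scalerAr.
Qed.

Lemma mat_br_linl e X X' Y : br (sc e X + X') Y = sc e (br X Y) + br X' Y.
Proof.
rewrite /mat_br mulmxDl mulmxDr mat_sc_mulmxl mat_sc_mulmxr.
by apply/matrixP => i j; rewrite !mxE scalerBr opprD addrACA.
Qed.

Lemma mat_brC X Y : br Y X = sc (-1) (br X Y).
Proof. by apply/matrixP => i j; rewrite !mxE scaleN1r opprB. Qed.

Lemma sl_subspace : subspace sc sl.
Proof.
split=> [|e X Y [s ->] [t ->]]; first by exists [::]; rewrite big_nil.
exists ([seq (e * u.1.1, u.1.2, u.2) | u <- s] ++ t).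
rewrite big_cat big_map mat_sc_sum; congr (_ + _).
by apply: eq_bigr => u _; rewrite mat_scA.
Qed.

Lemma sl_br X Y : sl (br X Y).
Proof. by exists [:: (1, X, Y)]; rewrite big_seq1 mat_sc1. Qed.

Lemma subspace_sum (P : 'M[A]_N -> Prop) (I : eqType) (s : seq I) (F : I -> 'M[A]_N) :
  subspace sc P -> (forall u, u \in s -> P (F u)) -> P (\sum_(u <- s) F u).
Proof.
move=> [P0 PD] PF; rewrite big_seq; elim/big_ind: _ => // X Y PX PY.
by rewrite -[X]mat_sc1; apply: PD.
Qed.

Lemma subspaceB (P : 'M[A]_N -> Prop) X Y : subspace sc P -> P X -> P Y -> P (X - Y).
Proof.
move=> [P0 PD] PX PY; rewrite addrC.
have -> : - Y = sc (-1) Y by apply/matrixP => i j; rewrite !mxE scaleN1r.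
exact: PD.
Qed.

Lemma sl_min (P : 'M[A]_N -> Prop) : subspace sc P -> (forall X Y, P (br X Y)) ->
  forall X, sl X -> P X.
Proof.
move=> sP Pbr _ [s ->]; apply: subspace_sum => // u _; exact: subspace_scale.
Qed.

Definition elem_mx i j x : 'M[A]_N := \matrix_(p, q) (if (p == i) && (q == j) then x else 0).

Lemma elem_mul i j x p q y :
  elem_mx i j x *m elem_mx p q y = if j == p then elem_mx i q (x * y) else 0.
Proof.
apply/matrixP => a b; rewrite !mxE.
case: (j =P p) => [->|jp].
  rewrite (bigD1 p) //= big1 ?addr0 => [|h /negPf hp]; rewrite !mxE ?eqxx ?andbT ?hp ?andbF ?mul0r //=.
  by case: (a == i); case: (b == q); rewrite ?mul0r ?mulr0.
rewrite big1 ?mxE // => h _; rewrite !mxE.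
case: (h =P j) => [->|_]; last by rewrite andbF mul0r.
by rewrite (introF eqP jp) mulr0.
Qed.

Lemma elem_mx_lin e x y i j : elem_mx i j (e *: x + y) = sc e (elem_mx i j x) + elem_mx i j y.
Proof. by apply/matrixP => p q; rewrite !mxE; case: ifP; rewrite ?scaler0 ?addr0. Qed.

Lemma elem_mx_sum X : X = \sum_i \sum_j elem_mx i j (X i j).
Proof.
apply/matrixP => p q; rewrite summxE (bigD1 p) //= summxE (bigD1 q) //= !mxE !eqxx /=.
rewrite big1 => [|j /negPf jq]; last by rewrite mxE eq_sym jq andbF.
rewrite addr0 big1 ?addr0 // => i /negPf ip; rewrite summxE big1 // => j _.
by rewrite mxE eq_sym ip.
Qed.

Lemma elem_br i j x p q y : br (elem_mx i j x) (elem_mx p q y) =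
  (if j == p then elem_mx i q (x * y) else 0) - (if q == i then elem_mx p j (y * x) else 0).
Proof. by rewrite /mat_br !elem_mul. Qed.

Lemma elem_offdiag i j x : i != j -> br (elem_mx i i 1) (elem_mx i j x) = elem_mx i j x.
Proof. by move=> ij; rewrite elem_br eqxx [j == i]eq_sym (negPf ij) mul1r subr0. Qed.

Lemma sl_elem i j x : i != j -> sl (elem_mx i j x).
Proof. by move=> ij; rewrite -(elem_offdiag x ij); apply: sl_br. Qed.

Definition kdiag_mx (d : 'I_N -> k) : 'M[A]_N := \matrix_(p, q) (if p == q then (d p)%:A else 0).

Lemma br_kdiag d X p q : br (kdiag_mx d) X p q = (d p - d q) *: X p q.
Proof.
rewrite !mxE (bigD1 p) //= big1 ?addr0 => [|h /negPf hp]; last by rewrite mxE eq_sym hp mul0r.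
rewrite (bigD1 q) //= [X in _ - (_ + X)]big1 ?addr0 => [|h /negPf hp]; last by rewrite mxE hp mulr0.
by rewrite !mxE !eqxx scalerBl -scalerAl -scalerAr mul1r mulr1.
Qed.

Lemma elem_br_inv i j x y : x * y = 1 -> y * x = 1 ->
  br (elem_mx i j x) (elem_mx j i y) = kdiag_mx (fun p => (p == i)%:R - (p == j)%:R).
Proof.
move=> xy yx; rewrite elem_br !eqxx xy yx; apply/matrixP => p q; rewrite !mxE.
have [->|pq] := eqVneq p q.
  by rewrite !andbb scalerBl; case: (q == i); case: (q == j); rewrite ?scale1r ?scale0r.
have F a : (p == a) && (q == a) = false.
  by apply/negP => /andP[/eqP pa /eqP qa]; rewrite pa qa eqxx in pq.
by rewrite !F subrr.
Qed.

End MatrixLie.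

Section SlTorus.

Variables (k : fieldType) (A : algType k) (n r : nat).
Variables (U : 'rV[int]_n -> A) (c : 'rV[int]_n -> 'rV[int]_n -> k).
Hypothesis tb : torus_basis U c.
Hypothesis r_gt0 : (0 < r)%N.

Local Notation br := (@mat_br k A r.+1).
Local Notation sc := (@mat_sc k A r.+1).
Local Notation sl := (@sl_set k A r.+1).

(** Homogeneity in the full matrix algebra. Testing the root on nonzero entries treats all [a]
    alike: diagonal matrices for a = 0, and only the zero matrix when [a] is not a root. *)
Definition hom_mx a l (X : 'M[A]_r.+1) := forall p q,
  (exists e : k, X p q = e *: U l) /\ (X p q != 0 -> rootA p q = a).

Definition sl_grading a l X := sl X /\ hom_mx a l X.

Lemma hom_subspace a l : subspace sc (hom_mx a l).
Proof.
split=> [p q|e X Y HX HY p q].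
  by rewrite mxE eqxx; split=> //; exists 0; rewrite scale0r.
have [[[eX XE] Xa] [[eY YE] Ya]] := (HX p q, HY p q).
rewrite !mxE; split; first by exists (e * eX + eY); rewrite XE YE scalerDl scalerA.
by have [->|/Xa//] := eqVneq (X p q) 0; rewrite scaler0 add0r.
Qed.

Lemma hom_mul a b l m X Y : hom_mx a l X -> hom_mx b m Y -> hom_mx (a + b) (l + m) (X *m Y).
Proof.
move=> HX HY p q; rewrite mxE.
have term h : (exists e : k, X p h * Y h q = e *: U (l + m)) /\
    (X p h * Y h q != 0 -> rootA p q = a + b).
  have [[[eX XE] Xa] [[eY YE] Ya]] := (HX p h, HY h q); split.
    by exists (eX * eY * c l m); rewrite XE YE -scalerAl -scalerAr (tb_mul tb) !scalerA.
  have [->|/Xa<-] := eqVneq (X p h) 0; first by rewrite mul0r eqxx.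
  have [->|/Ya<-] := eqVneq (Y h q) 0; first by rewrite mulr0 eqxx.
  by rewrite /rootA addrA subrK.
elim/big_ind: _ => [|x y [[e ->] Hx] [[f ->] Hy]|h _]; last exact: term.
  by rewrite eqxx; split=> //; exists 0; rewrite scale0r.
split; first by exists (e + f); rewrite scalerDl.
by have [->|/Hx//] := eqVneq (e *: U (l + m)) 0; rewrite add0r.
Qed.

Lemma hom_br a b l m X Y : hom_mx a l X -> hom_mx b m Y -> hom_mx (a + b) (l + m) (br X Y).
Proof.
move=> HX HY; apply: (subspaceB (hom_subspace _ _)); first exact: hom_mul.
by rewrite addrC [l + m]addrC; apply: hom_mul.
Qed.

Lemma hom_elem i j l e : hom_mx (rootA i j) l (elem_mx i j (e *: U l)).
Proof.
move=> p q; rewrite mxE; case: ifP => [/andP[/eqP-> /eqP->]|_]; first by split=> //; exists e.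
by rewrite eqxx; split=> //; exists 0; rewrite scale0r.
Qed.

(** By bilinearity the derived algebra is spanned by brackets of homogeneous elementary matrices.
    This is what makes it a graded subspace. *)
Lemma sl_min_hom (P : 'M[A]_r.+1 -> Prop) : subspace sc P ->
  (forall i j l p q m, P (br (elem_mx i j (U l)) (elem_mx p q (U m)))) ->
  forall X, sl X -> P X.
Proof.
move=> sP PU; have span_elem (Q : 'M[A]_r.+1 -> Prop) : subspace sc Q ->
    (forall i j l, Q (elem_mx i j (U l))) -> forall X, Q X.
  move=> sQ QU X; rewrite [X]elem_mx_sum.
  apply: subspace_sum => // i _; apply: subspace_sum => // j _.
  rewrite [X i j](tcoef_sum tb); elim/big_rec: _ => [|l x _ IH].
    have -> : elem_mx i j 0 = 0 :> 'M[A]_r.+1 by apply/matrixP => p q; rewrite !mxE if_same.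
    exact: sQ.1.
  by rewrite elem_mx_lin; apply: sQ.2.
apply: sl_min => // X Y; refine (span_elem (fun X => P (br X Y)) _ _ X) => [|i j l].
  split=> [|e Z Z' PZ PZ']; last by rewrite mat_br_linl; apply: sP.2.
  by rewrite /mat_br mul0mx mulmx0 subrr; apply: sP.1.
refine (span_elem (fun Y => P (br (elem_mx i j (U l)) Y)) _ _ Y) => //.
split=> [|e Z Z' PZ PZ']; first by rewrite /mat_br mul0mx mulmx0 subrr; apply: sP.1.
have sym V W : P (br V W) -> P (br W V).
  by move=> H; rewrite mat_brC; apply: subspace_scale.
by apply: (sym); rewrite mat_br_linl; apply: sP.2; apply: (sym).
Qed.

Lemma sl_grading_span X : sl X -> exists s : seq ('rV[rat]_r * 'rV[int]_n * 'M[A]_r.+1),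
  (forall u, u \in s -> sl_grading u.1.1 u.1.2 u.2) /\ X = \sum_(u <- s) u.2.
Proof.
move: X; apply: sl_min_hom => [|i j l p q m].
  split=> [|e X Y [s [sG ->]] [t [tG ->]]]; first by exists [::]; rewrite big_nil.
  exists ([seq (u.1, sc e u.2) | u <- s] ++ t); split.
    move=> u; rewrite mem_cat => /orP[/mapP[v vs ->]|/tG//] /=.
    have [vsl vh] := sG v vs.
    split; [exact: (subspace_scale _ (@sl_subspace k A r.+1))|].
    exact: (subspace_scale _ (hom_subspace _ _)).
  by rewrite big_cat big_map mat_sc_sum.
exists [:: (rootA i j + rootA p q, l + m, br (elem_mx i j (U l)) (elem_mx p q (U m)))].
split=> [u|]; last by rewrite big_seq1.
rewrite inE => /eqP-> /=; split; first exact: sl_br.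
by rewrite -[U l]scale1r -[U m]scale1r; apply: hom_br; apply: hom_elem.
Qed.

(** A position (p, q) fixes the root and a coefficient index fixes the lattice degree, so each
    coefficient of each entry comes from at most one term. *)
Lemma sl_grading_free (s : seq ('rV[rat]_r * 'rV[int]_n * 'M[A]_r.+1)) :
  uniq (map fst s) -> (forall u, u \in s -> sl_grading u.1.1 u.1.2 u.2) ->
  \sum_(u <- s) u.2 = 0 -> forall u, u \in s -> u.2 = 0.
Proof.
move=> us sG s0 u u_s; apply/matrixP => p q; rewrite [RHS]mxE.
apply/eqP/negPn/negP => u0; have [_ /(_ p q)[[e uE] /(_ u0) ua]] := sG u u_s.
have := congr1 (fun X : 'M_ _ => tcoef tb (X p q) u.1.2) s0.
rewrite summxE tcoef_sumE mxE tcoef0 (bigD1_seq u) ?(map_uniq us) //= big_seq_cond big1 ?addr0.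
  by rewrite uE tcoefZ tcoefU eqxx mulr1 => e0; rewrite uE e0 scale0r eqxx in u0.
move=> v /andP[vs vu]; have [_ /(_ p q)[[f vE] va]] := sG v vs.
have [->|v0] := eqVneq (v.2 p q) 0; first exact: tcoef0.
rewrite vE tcoefZ tcoefU; case: eqP => [e1|]; last by rewrite mulr0.
case/eqP: vu; apply: (uniq_map_inj_in us) => //.
by rewrite [v.1]surjective_pairing -(va v0) -e1 ua -surjective_pairing.
Qed.

Lemma sl_grading_br a b l m X Y :
  sl_grading a l X -> sl_grading b m Y -> sl_grading (a + b) (l + m) (br X Y).
Proof. by move=> [_ HX] [_ HY]; split; [exact: sl_br|exact: hom_br]. Qed.

Lemma sl_grading_elem i j l e : i != j ->
  sl_grading (rootA i j) l (elem_mx i j (e *: U l)).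
Proof. by move=> ij; split; [exact: sl_elem|exact: hom_elem]. Qed.

Lemma sl_grading_rootE i j l X : i != j ->
  sl_grading (rootA i j) l X <-> exists e, X = sc e (elem_mx i j (U l)).
Proof.
move=> ij; split=> [[_ HX]|[e ->]]; last first.
  have -> : sc e (elem_mx i j (U l)) = elem_mx i j (e *: U l).
    by apply/matrixP => p q; rewrite !mxE; case: ifP => // _; rewrite scaler0.
  exact: sl_grading_elem.
have [[e XE] _] := HX i j; exists e; apply/matrixP => p q; rewrite !mxE.
case: ifP => [/andP[/eqP-> /eqP->]//|pq]; rewrite scaler0; apply/eqP/negPn/negP => X0.
have [_ /(_ X0)/esym/(rootA_inj ij)[ip jq]] := HX p q.
by rewrite ip jq !eqxx in pq.
Qed.

Lemma elem_mx_neq0 i j x : x != 0 -> elem_mx i j x != 0 :> 'M[A]_r.+1.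
Proof. by apply: contra_neq => /matrixP/(_ i j); rewrite !mxE !eqxx. Qed.

Lemma sl_grading_cartan i j : i != j ->
  sl_grading 0 0 (kdiag_mx A (fun p => (p == i)%:R - (p == j)%:R)).
Proof.
move=> ij; have ji : j != i by rewrite eq_sym.
have := sl_grading_br (sl_grading_elem 0 (c 0 0)^-1 ij) (sl_grading_elem 0 (c 0 0)^-1 ji).
by rewrite -(torus1 tb) (elem_br_inv i j (mulr1 1) (mulr1 1)) /rootA addrA subrK subrr addr0.
Qed.

Lemma sl_grading00 X : sl_grading 0 0 X -> exists d, X = kdiag_mx A d.
Proof.
move=> [_ HX]; have [d dE] := functional_choice _ (fun p => (HX p p).1).
exists (fun p => d p * c 0 0); apply/matrixP => p q; rewrite mxE.
case: (p =P q) => [->|/eqP pq].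
  by rewrite dE (torus1 tb) scalerA mulfK // (tb_neq0 tb).
by apply/eqP/negPn/negP => /(HX p q).2/eqP; rewrite rootA_eq0 (negPf pq).
Qed.

Lemma sl_grading_nz i j l : i != j -> exists2 X, sl_grading (rootA i j) l X & X != 0.
Proof.
move=> ij; exists (elem_mx i j (1 *: U l)); first exact: sl_grading_elem.
by rewrite elem_mx_neq0 // scale1r (tU_neq0 tb).
Qed.

Lemma ord0_neq_max : ord0 != ord_max :> 'I_r.+1.
Proof. by rewrite -val_eqE /= eq_sym -lt0n. Qed.

Lemma sl_support a : (exists l, exists2 X, sl_grading a l X & X != 0) <-> a \in rootsA r.
Proof.
split=> [[l [X [_ HX] X0]]|/rootAP[i [j ->]]].
  have [p [q Xpq]] : exists p q, X p q != 0.
    apply: NNPP => nex; case/eqP: X0; apply/matrixP => p q; rewrite mxE.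
    by apply/eqP/negPn/negP => Xpq; apply: nex; exists p, q.
  by apply/rootAP; exists p, q; rewrite (HX p q).2.
have [->|ij] := eqVneq i j; last by exists 0; apply: sl_grading_nz.
exists 0; rewrite /rootA subrr; eexists; first exact: sl_grading_cartan ord0_neq_max.
apply/eqP => /matrixP/(_ ord0 ord0); rewrite !mxE !eqxx (negPf ord0_neq_max) subr0 scale1r.
by apply/eqP; rewrite oner_eq0.
Qed.

Lemma sl_grading_triple a l : a != 0 -> (exists2 X, sl_grading a l X & X != 0) ->
  exists e f, [/\ (forall X, sl_grading a l X <-> exists b, X = sc b e),
    (forall X, sl_grading (- a) (- l) X <-> exists b, X = sc b f) &
    forall cor, is_coroot (rootsA r) a cor -> forall b m X, sl_grading b m X ->
      br (br e f) X = sc (ratr (cor b)) X].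
Proof.
move=> a0 Xnz; have /rootAP[i [j aE]] : a \in rootsA r by apply/sl_support; exists l.
have ij : i != j by rewrite aE rootA_eq0 in a0.
have ji : j != i by rewrite eq_sym.
have [b [UV VU]] := tU_inv tb l.
have b0 : b != 0.
  by apply: contra_eq_neq UV => ->; rewrite scale0r mulr0 eq_sym oner_eq0.
exists (elem_mx i j (U l)), (elem_mx j i (b *: U (- l))); split.
- by rewrite aE => X; apply: sl_grading_rootE.
- move=> X; have -> : - a = rootA j i by rewrite aE /rootA opprB.
  rewrite sl_grading_rootE //.
  have -> : elem_mx j i (b *: U (- l)) = sc b (elem_mx j i (U (- l))).
    by apply/matrixP => p q; rewrite !mxE; case: ifP => // _; rewrite scaler0.
  split=> -[d ->]; last by exists (d * b); rewrite mat_scA.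
  by exists (d / b); rewrite mat_scA divfK.
move=> cor corP d m X GX; rewrite (elem_br_inv i j UV VU).
apply/matrixP => p q; rewrite br_kdiag mat_scE.
have [->|X0] := eqVneq (X p q) 0; first by rewrite !scaler0.
have dE := (GX.2 p q).2 X0; congr (_ *: _).
have dR : d \in rootsA r by apply/rootAP; exists p, q.
have ijR : is_coroot (rootsA r) a (corootA i j) by rewrite aE; apply: rootA_coroot.
(* The axiom ranges over every functional that qualifies as a coroot; on the roots they all agree
   with [corootA i j]. *)
rewrite (is_coroot_unique a0 corP ijR dR) -dE corootAE ratr_int.
by rewrite !rmorphB /= !rmorph_nat.
Qed.

Lemma sl_generated (X : 'M[A]_r.+1) : sl X <-> forall P : 'M[A]_r.+1 -> Prop,
  subspace sc P -> (forall Y Z, P Y -> P Z -> P (br Y Z)) ->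
  (forall a l Y, a != 0 -> sl_grading a l Y -> P Y) -> P X.
Proof.
split=> [slX P sP Pbr PG|]; last first.
  apply; [exact: sl_subspace|by move=> *; exact: sl_br|by move=> a l Y _ []].
have Poff i j x : i != j -> P (elem_mx i j x).
  move=> ij; rewrite [x](tcoef_sum tb); elim/big_rec: _ => [|l y _ IH].
    have -> : elem_mx i j 0 = 0 :> 'M[A]_r.+1 by apply/matrixP => p q; rewrite !mxE if_same.
    exact: sP.1.
  rewrite elem_mx_lin; apply: sP.2 => //; rewrite -[U l]scale1r.
  by apply: (PG (rootA i j) l); [rewrite rootA_eq0|exact: sl_grading_elem].
have Pcart i j x y : i != j -> P (elem_mx i i (x * y) - elem_mx j j (y * x)).
  move=> ij; have -> : elem_mx i i (x * y) - elem_mx j j (y * x) =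
      br (elem_mx i j x) (elem_mx j i y) by rewrite elem_br !eqxx.
  by apply: Pbr; apply: Poff; rewrite // eq_sym.
apply: sl_min_hom X slX => // i j l p q m; rewrite elem_br.
have [jp|jp] := eqVneq j p; have [qi|qi] := eqVneq q i.
- rewrite {}qi -{}jp; have [->|ij] := eqVneq i j; last exact: Pcart.
  (* A commutator in a single diagonal position is a difference of two brackets of opposite root
     vectors through an auxiliary index [h], whose entries at [h] cancel. *)
  have [h jh] : exists h : 'I_r.+1, j != h.
    have [->|j0] := eqVneq j ord0; last by exists ord0.
    by exists ord_max; exact: ord0_neq_max.
  have -> : elem_mx j j (U l * U m) - elem_mx j j (U m * U l) =
     (elem_mx j j (U l * U m) - elem_mx h h (U m * U l)) -
     (elem_mx j j (U m * U l * 1) - elem_mx h h (1 * (U m * U l))) :> 'M[A]_r.+1.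
    by rewrite mulr1 mul1r opprB addrA subrK.
  by apply: (subspaceB sP); apply: Pcart.
- by rewrite subr0; apply: Poff; rewrite eq_sym.
- by rewrite sub0r -[- _]add0r; apply: (subspaceB sP); [exact: sP.1|apply: Poff; rewrite eq_sym].
by rewrite subrr; exact: sP.1.
Qed.

Lemma sl_lie_torus : lie_torus sc br sl (rootsA r) sl_grading.
Proof.
split; first exact: root_system_rootsA.
- split; [|exact: sl_grading_span|exact: sl_grading_free|exact: sl_grading_br].
  move=> a l; split=> [|X []//].
  have [[s0 sD] [h0 hD]] := (@sl_subspace k A r.+1, hom_subspace a l).
  by split=> [|e X Y [sX hX] [sY hY]]; split=> //; [exact: sD|exact: hD].
- exact: sl_support.
split.
- move=> _ /rootAP[i [j ->]] + _; rewrite rootA_eq0; exact: sl_grading_nz.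
- move=> a l a0 Xnz; have [e [f [He Hf Hef]]] := sl_grading_triple a0 Xnz.
  exists e, f; split=> // cor corP b _ [s [sG ->]].
  have lin : {morph br (br e f) : X Y / X + Y}.
    move: (br e f) => W X Y.
    by rewrite /mat_br mulmxDl mulmxDr opprD addrACA.
  have br0 : br (br e f) 0 = 0 by rewrite /mat_br mul0mx mulmx0 subrr.
  rewrite (big_morph _ lin br0) mat_sc_sum big_seq [RHS]big_seq.
  by apply: eq_bigr => u us; apply: (Hef cor corP b u.1); apply: sG.
- exact: sl_generated.
move=> mu; exists [:: (1, mu)]; split=> [u|]; last by rewrite big_seq1 scale1r.
rewrite inE => /eqP-> /=; exists (rootA ord0 ord_max).
by apply: sl_grading_nz; exact: ord0_neq_max.
Qed.

End SlTorus.

(** * Transport along Lie isomorphisms *)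

Section Transport.

Variables (k : fieldType) (V V' : zmodType).
Variables (sc : k -> V -> V) (br : V -> V -> V) (S : V -> Prop).
Variables (sc' : k -> V' -> V') (br' : V' -> V' -> V') (S' : V' -> Prop).
Hypotheses (sc1 : forall x, sc 1 x = x) (sc1' : forall x, sc' 1 x = x).
Hypotheses (S_sub : subspace sc S) (S_br : forall x y, S x -> S y -> S (br x y)).
Variable f : V -> V'.
Hypothesis f_isom : lie_isom sc br S sc' br' S' f.

Lemma lie_isom0 : f 0 = 0.
Proof.
have [_ fL _ _ _] := f_isom; have [S0 _] := S_sub.
by have := fL 1 0 0 S0 S0; rewrite sc1 sc1' addr0 => /esym/(canRL (addrK _)); rewrite subrr.
Qed.

Lemma lie_isomZ a x : S x -> f (sc a x) = sc' a (f x).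
Proof.
have [_ fL _ _ _] := f_isom; have [S0 _] := S_sub.
by move=> Sx; have := fL a x 0 Sx S0; rewrite lie_isom0 !addr0.
Qed.

Lemma lie_isom_sum (I : eqType) (s : seq I) (F : I -> V) :
  (forall i, i \in s -> S (F i)) ->
  S (\sum_(i <- s) F i) /\ f (\sum_(i <- s) F i) = \sum_(i <- s) f (F i).
Proof.
have [_ fL _ _ _] := f_isom; have [S0 SD] := S_sub.
elim: s => [|i s IH] SF; first by rewrite !big_nil lie_isom0.
have [|Ss fs] := IH; first by move=> j js; apply: SF; rewrite inE js orbT.
have Si : S (F i) by apply: SF; rewrite mem_head.
by rewrite !big_cons -fs; have := SD 1 _ _ Si Ss; have := fL 1 _ _ Si Ss; rewrite sc1 sc1'.
Qed.

(** Pullback of the grading along [f]. Since [f] is linear and injective on [S] only, the new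
    components must include membership in [S]. *)
Lemma lie_torus_transport m p (D : seq 'rV[rat]_m)
    (G : 'rV[rat]_m -> 'rV[int]_p -> V' -> Prop) :
  lie_torus sc' br' S' D G ->
  lie_torus sc br S D (fun a l x => S x /\ G a l (f x)).
Proof.
have [fS fL finj fsur fbr] := f_isom; have [S0 SD] := S_sub.
move=> [HD [Gsub Gspan Gfree Gbr] Gsupp [Gint Gef Ggen Glam]].
have GS a l x : G a l x -> S' x by case: (Gsub a l) => _; apply.
have [g gP] : exists g, forall y, S' y -> S (g y) /\ f (g y) = y.
  apply: (functional_choice (fun y x => S' y -> S x /\ f x = y)) => y.
  have [/fsur[x Sx fx]|nSy] := classic (S' y); first by exists x.
  by exists 0 => /nSy.
have nz a l : (exists2 x, S x /\ G a l (f x) & x != 0) <-> (exists2 y, G a l y & y != 0).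
  split=> [[x [Sx Gx] x0]|[y Gy y0]].
    exists (f x) => //; apply: contra x0 => /eqP fx0.
    by apply/eqP/finj; rewrite // lie_isom0.
  have [Sy fy] := gP y (GS _ _ _ Gy); exists (g y); first by rewrite fy.
  by apply: contra_neq y0 => gy; rewrite -fy gy lie_isom0.
split=> //.
- split.
  + move=> a l; split=> [|x []//]; have [[G0 GD] _] := Gsub a l.
    split=> [|b x y [Sx Gx] [Sy Gy]]; first by rewrite lie_isom0.
    by split; [exact: SD|rewrite fL //; exact: GD].
  + move=> x Sx; have [s [sG fx]] := Gspan _ (fS _ Sx).
    have sgP u : u \in s -> S (g u.2) /\ f (g u.2) = u.2.
      by move=> us; apply: gP; apply: GS (sG u us).
    exists [seq (u.1, g u.2) | u <- s]; split.
      by move=> _ /mapP[u us ->] /=; have [Su ->] := sgP u us; split=> //; apply: sG.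
    have [Ss fs] : S (\sum_(u <- s) g u.2) /\ f (\sum_(u <- s) g u.2) = \sum_(u <- s) f (g u.2).
      by apply: lie_isom_sum => u /sgP[].
    rewrite big_map; apply: finj => //; rewrite fs fx big_seq [RHS]big_seq.
    by apply: eq_bigr => u /sgP[_ ->].
  + move=> s us sG s0 u u_s.
    have [Su Gu] := sG u u_s; apply: finj => //; rewrite lie_isom0.
    have us' : uniq (map fst [seq (v.1, f v.2) | v <- s]) by rewrite -map_comp.
    have sG' v : v \in [seq (v.1, f v.2) | v <- s] -> G v.1.1 v.1.2 v.2.
      by move=> /mapP[w ws ->]; have [] := sG w ws.
    have s0' : \sum_(v <- [seq (v.1, f v.2) | v <- s]) v.2 = 0.
      rewrite big_map; have [|_ <-] := @lie_isom_sum _ s (fun v => v.2).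
        by move=> v vs; have [] := sG v vs.
      by rewrite s0 lie_isom0.
    exact: (Gfree _ us' sG' s0' _ (map_f (fun v => (v.1, f v.2)) u_s)).
  + move=> a b l l' x y [Sx Gx] [Sy Gy]; split; first exact: S_br.
    by rewrite fbr //; exact: Gbr.
- move=> a; rewrite -Gsupp; split=> -[l /nz H]; by exists l.
split.
- by move=> a aD a0 a2; apply/nz; exact: Gint.
- move=> a l a0 /nz/(Gef a l a0)[e [e' [He He' Hee']]].
  have Ge : G a l e by apply/He; exists 1.
  have Ge' : G (- a) (- l) e' by apply/He'; exists 1.
  have [[Sge fge] [Sge' fge']] := (gP e (GS _ _ _ Ge), gP e' (GS _ _ _ Ge')).
  exists (g e), (g e'); split.
  + move=> x; split=> [[Sx /He[b fx]]|[b ->]].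
      exists b; apply: finj => //; first exact: (subspace_scale _ S_sub).
      by rewrite lie_isomZ // fge.
    by split; [exact: (subspace_scale _ S_sub)|rewrite lie_isomZ // fge; apply/He; exists b].
  + move=> x; split=> [[Sx /He'[b fx]]|[b ->]].
      exists b; apply: finj => //; first exact: (subspace_scale _ S_sub).
      by rewrite lie_isomZ // fge'.
    by split; [exact: (subspace_scale _ S_sub)|rewrite lie_isomZ // fge'; apply/He'; exists b].
  move=> cor corP b x [s [sG xE]].
  have [Sx fx] := @lie_isom_sum _ s (fun u => u.2) (fun u us => (sG u us).1).
  have Sb : S (br (g e) (g e')) by exact: S_br.
  rewrite -xE in Sx fx.
  apply: finj; [exact: S_br|exact: (subspace_scale _ S_sub)|].
  rewrite !fbr // fge fge' lie_isomZ //; apply: (Hee' cor corP b).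
  exists [seq (u.1, f u.2) | u <- s]; split; last by rewrite fx big_map.
  by move=> _ /mapP[u us ->]; have [] := sG u us.
- move=> x; split=> [Sx P [P0 PD] Pbr PG|]; last first.
    apply; [exact: S_sub|by move=> *; exact: S_br|by move=> a l y _ []].
  have : exists z, [/\ S z, P z & f z = f x].
    apply: ((Ggen (f x)).1 (fS _ Sx) (fun y => exists z, [/\ S z, P z & f z = y])).
    + split=> [|a y y' [z [Sz Pz <-]] [z' [Sz' Pz' <-]]].
        by exists 0; rewrite lie_isom0.
      by exists (sc a z + z'); rewrite fL //; split=> //; [exact: SD|exact: PD].
    + move=> y y' [z [Sz Pz <-]] [z' [Sz' Pz' <-]].
      by exists (br z z'); rewrite fbr //; split=> //; [exact: S_br|exact: Pbr].
    move=> a l y a0 Gy; have [Sy fy] := gP y (GS _ _ _ Gy).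
    by exists (g y); split=> //; apply: (PG a l); rewrite ?fy.
  by case=> z [Sz Pz /(finj _ _ Sz Sx) <-].
move=> mu; have [s [sG ->]] := Glam mu; exists s; split=> // u /sG[a /nz H].
by exists a.
Qed.

End Transport.

Lemma lie_isom_comp (k : fieldType) (V1 V2 V3 : zmodType)
  (sc1 : k -> V1 -> V1) br1 S1 (sc2 : k -> V2 -> V2) br2 S2 (sc3 : k -> V3 -> V3) br3 S3 f g :
  lie_isom sc1 br1 S1 sc2 br2 S2 f -> lie_isom sc2 br2 S2 sc3 br3 S3 g ->
  lie_isom sc1 br1 S1 sc3 br3 S3 (g \o f).
Proof.
move=> [fS fL fI fO fB] [gS gL gI gO gB]; split=> /=.
- by move=> x /fS/gS.
- by move=> a x y Sx Sy; rewrite /= fL // gL //; apply: fS.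
- by move=> x y Sx Sy /gI e; apply: fI => //; apply: e; apply: fS.
- by move=> z /gO[y /fO[x Sx <-] <-]; exists x.
by move=> x y Sx Sy; rewrite fB // gB //; apply: fS.
Qed.

Lemma alg_isomorphic_lie (k : fieldType) (A A' : algType k) N :
  alg_isomorphic A A' ->
  lie_isomorphic (@mat_sc k A N) (@mat_br k A N) (@sl_set k A N)
                 (@mat_sc k A' N) (@mat_br k A' N) (@sl_set k A' N).
Proof.
move=> [f [g fK gK]]; exists (map_mx f).
have fZ a (X : 'M[A]_N) : map_mx f (mat_sc a X) = mat_sc a (map_mx f X).
  by apply/matrixP => i j; rewrite !mxE linearZ.
have fB (X Y : 'M[A]_N) : map_mx f (mat_br X Y) = mat_br (map_mx f X) (map_mx f Y).
  by rewrite /mat_br map_mxB !map_mxM.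
have mK : cancel (map_mx g) (map_mx f : 'M[A]_N -> 'M[A']_N).
  by move=> X; apply/matrixP => i j; rewrite !mxE gK.
split=> //.
- move=> _ [s ->]; exists [seq (u.1.1, map_mx f u.1.2, map_mx f u.2) | u <- s].
  by rewrite raddf_sum big_map; apply: eq_bigr => u _; rewrite /= fZ fB.
- by move=> a X Y _ _; rewrite map_mxD fZ.
- move=> X Y _ _ /matrixP e; apply/matrixP => i j.
  by have := e i j; rewrite !mxE => /(can_inj fK).
move=> _ [s ->].
exists (\sum_(u <- [seq (u.1.1, map_mx g u.1.2, map_mx g u.2) | u <- s]) mat_sc u.1.1 (mat_br u.1.2 u.2)).
  by eexists.
by rewrite raddf_sum big_map; apply: eq_bigr => u _; rewrite /= fZ fB !mK.
Qed.

(** * Isomorphisms preserving the Cartan subalgebra *)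

Lemma elem_triple (k : fieldType) (A : algType k) N (i j : 'I_N) (x y z : A) : i != j ->
  mat_br (mat_br (elem_mx i j x) (elem_mx j i y)) (elem_mx i j z) =
  elem_mx i j (x * y * z + z * y * x).
Proof.
move=> ij; rewrite elem_br !eqxx /mat_br mulmxBl mulmxBr !elem_mul !eqxx.
rewrite [j == i]eq_sym (negPf ij) subr0 sub0r opprK mulrA.
by rewrite -[elem_mx i j (x * y * z)]mat_sc1 -elem_mx_lin scale1r.
Qed.

(** The matrix e_ii - e_jj. Its adjoint action on a root space is multiplication by the value of the
    coroot of e_i - e_j. *)
Definition coroot_mx (k : fieldType) (A : algType k) N (i j : 'I_N) : 'M[A]_N :=
  kdiag_mx A (fun p => (p == i)%:R - (p == j)%:R).

(** On the other roots, and on 0, the coroot of e_i - e_j takes values between -2 and 1, which stay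
    different from 2 in characteristic 0. *)
Lemma coroot_eigen (k : fieldType) (A : algType k) N (i j : 'I_N) (X : 'M[A]_N) :
  [pchar k] =i pred0 -> i != j -> mat_br (coroot_mx A i j) X = mat_sc 2 X ->
  X = elem_mx i j (X i j).
Proof.
move=> chk ij /matrixP XE; apply/matrixP => p q; rewrite mxE.
case: ifP => [/andP[/eqP-> /eqP->]//|pq]; apply/eqP/negPn/negP => X0.
have /eqP := XE p q; rewrite br_kdiag mat_scE -subr_eq0 -scalerBl scaler_eq0 (negPf X0) orbF.
have nz m : m.+1%:R != 0 :> k by rewrite ((pcharf0P k).1 chk).
apply/negP; move: pq; have [->|pi] := eqVneq p i; have [->|qj] := eqVneq q j => // _.
- rewrite (negPf ij); case: (q == i).
    by rewrite /= (_ : _ - _ = - 2%:R) ?oppr_eq0 //; ring.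
  by rewrite /= (_ : _ - _ = - 1%:R) ?oppr_eq0 //; ring.
- rewrite [j == i]eq_sym (negPf ij); case: (p == j).
    by rewrite /= (_ : _ - _ = - 2%:R) ?oppr_eq0 //; ring.
  by rewrite /= (_ : _ - _ = - 1%:R) ?oppr_eq0 //; ring.
case: (p == j); case: (q == i).
- by rewrite /= (_ : _ - _ = - 4%:R) ?oppr_eq0 //; ring.
- by rewrite /= (_ : _ - _ = - 3%:R) ?oppr_eq0 //; ring.
- by rewrite /= (_ : _ - _ = - 3%:R) ?oppr_eq0 //; ring.
by rewrite /= (_ : _ - _ = - 2%:R) ?oppr_eq0 //; ring.
Qed.

Lemma coroot_mxN (k : fieldType) (A : algType k) N (i j : 'I_N) (X : 'M[A]_N) :
  mat_br (coroot_mx A j i) X = mat_sc (-1) (mat_br (coroot_mx A i j) X).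
Proof.
apply/matrixP => p q; rewrite mat_scE !br_kdiag scalerA; congr (_ *: _); ring.
Qed.

Lemma br_kdiag_elem (k : fieldType) (A : algType k) N (d : 'I_N -> k) i j (x : A) :
  mat_br (kdiag_mx A d) (elem_mx i j x) = mat_sc (d i - d j) (elem_mx i j x).
Proof.
apply/matrixP => p q; rewrite br_kdiag mat_scE mxE.
by case: ifP => [/andP[/eqP-> /eqP->]|]; rewrite ?scaler0.
Qed.

Section Forward.

Variables (k : closedFieldType) (A A' : algType k) (n r : nat).
Hypothesis chk : [pchar k] =i pred0.
Variables (U : 'rV[int]_n -> A) (c : 'rV[int]_n -> 'rV[int]_n -> k).
Variables (U' : 'rV[int]_n -> A') (c' : 'rV[int]_n -> 'rV[int]_n -> k).
Hypotheses (tb : torus_basis U c) (tb' : torus_basis U' c').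
Hypotheses (r_gt0 : (0 < r)%N).

Local Notation sl := (@sl_set k A r.+1).
Local Notation sl' := (@sl_set k A' r.+1).

Variable F : 'M[A]_r.+1 -> 'M[A']_r.+1.
Hypothesis F_isom : lie_isom (@mat_sc k A r.+1) (@mat_br k A r.+1) sl
                             (@mat_sc k A' r.+1) (@mat_br k A' r.+1) sl' F.
Hypothesis F_cartan : forall H', sl_grading U' 0 0 H' <->
  exists2 H, sl_grading U 0 0 H & H' = F H.

(** Whether [F] maps coroots to coroots is not known beforehand: the image of the coroot for (0, r)
    and the preimage of the one for (p, q) are merely diagonal. One nonzero entry (p, q) of the
    image of e_0r fixes the eigenvalue 2 for both, and [coroot_eigen] then confines the root
    spaces. *)
Lemma cartan_isom_root_spaces : exists p q : 'I_r.+1, [/\ p != q,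
  forall x, F (elem_mx ord0 ord_max x) = elem_mx p q (F (elem_mx ord0 ord_max x) p q),
  forall x, F (elem_mx ord_max ord0 x) = elem_mx q p (F (elem_mx ord_max ord0 x) q p) &
  forall y, exists x, F (elem_mx ord0 ord_max x) = elem_mx p q y].
Proof.
have [FS FL Finj Fsur Fbr] := F_isom.
have two0 : 2 != 0 :> k by rewrite ((pcharf0P k).1 chk).
have ij := ord0_neq_max r_gt0; set i := ord0 in ij *; set j := ord_max in ij *.
have ji : j != i by rewrite eq_sym.
have FZ a X : sl X -> F (mat_sc a X) = mat_sc a (F X).
  apply: (lie_isomZ _ _ _ F_isom); [exact: mat_sc1|exact: mat_sc1|exact: sl_subspace].
have GH0 : sl_grading U 0 0 (coroot_mx A i j) := sl_grading_cartan tb ij.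
have [d' Hd'] := sl_grading00 tb' ((F_cartan _).2 (ex_intro2 _ _ _ GH0 erefl)).
have H0E x : mat_br (coroot_mx A i j) (elem_mx i j x) = mat_sc 2 (elem_mx i j x).
  by rewrite br_kdiag_elem !eqxx (negPf ij) (negPf ji); congr mat_sc => /=; ring.
have F0 : F 0 = 0 by apply: (lie_isom0 _ _ _ F_isom);
  [exact: mat_sc1|exact: mat_sc1|exact: sl_subspace].
have [p [q Xpq]] : exists p q, F (elem_mx i j 1) p q != 0.
  apply: NNPP => nex; have : elem_mx i j 1 != 0 :> 'M[A]_r.+1.
    by apply: elem_mx_neq0; rewrite oner_eq0.
  move/eqP; apply; apply: Finj; [exact: sl_elem|exact: (@sl_subspace _ _ _).1|].
  rewrite F0; apply/matrixP => p q; rewrite mxE.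
  by apply/eqP/negPn/negP => Xpq; apply: nex; exists p, q.
have d2 : d' p - d' q = 2.
  have := congr1 F (H0E 1); rewrite Fbr ?FZ; [|exact: sl_elem|exact: GH0.1|exact: sl_elem].
  move/matrixP/(_ p q); rewrite Hd' br_kdiag mat_scE => /eqP.
  by rewrite -subr_eq0 -scalerBl scaler_eq0 (negPf Xpq) orbF subr_eq0 => /eqP.
have pq : p != q by apply: contraNneq two0 => pq; rewrite -d2 pq subrr.
have [H1 GH1 FH1] := (F_cartan _).1 (sl_grading_cartan tb' pq).
have [d Hd] := sl_grading00 tb GH1.
have brF s t x : s != t -> mat_br (coroot_mx A' p q) (F (elem_mx s t x)) =
    mat_sc (d s - d t) (F (elem_mx s t x)).
  move=> st; rewrite [coroot_mx _ _ _]FH1 -Fbr; [|exact: GH1.1|exact: sl_elem].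
  by rewrite Hd br_kdiag_elem FZ //; apply: sl_elem.
(* This eigenvalue does not depend on [x], so it is read at x = 1, where the entry (p, q) is nonzero
   and [coroot_mx A' p q] scales it by 2. *)
have dij : d i - d j = 2.
  have := brF i j 1 ij => /matrixP/(_ p q); rewrite br_kdiag mat_scE => /eqP.
  rewrite -subr_eq0 -scalerBl scaler_eq0 (negPf Xpq) orbF !eqxx.
  by rewrite (negPf pq) [q == p]eq_sym (negPf pq) subr_eq0 => /eqP<- /=; ring.
exists p, q; split=> // [x|x|y].
- by apply: coroot_eigen => //; rewrite brF // dij.
- apply: coroot_eigen => //; first by rewrite eq_sym.
  rewrite coroot_mxN brF // mat_scA; congr mat_sc.
  by rewrite mulN1r opprB.
(* Surjectivity runs backwards: by [d2] the image of [coroot_mx A i j] acts on [F X] as 2, so [X]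
   itself is an eigenvector for 2. *)
have [X sX FX] := Fsur _ (sl_elem y pq).
suff XE : X = elem_mx i j (X i j) by exists (X i j); rewrite -XE.
apply: coroot_eigen => //; apply: Finj; [exact: sl_br|exact: (subspace_scale _ (@sl_subspace _ _ _))|].
rewrite Fbr ?FZ //; last exact: GH0.1.
by rewrite Hd' FX br_kdiag_elem d2.
Qed.

Lemma cartan_isom_alg_isomorphic : assoc_fgc A' -> alg_isomorphic A A'.
Proof.
move=> fgc; have [FS FL Finj Fsur Fbr] := F_isom.
have ij := ord0_neq_max r_gt0; have ji : ord_max != ord0 :> 'I_r.+1 by rewrite eq_sym.
have [p [q [pq FE FE' Fon]]] := cartan_isom_root_spaces.
have [t [tbij tM]] := torus_antiautomorphism chk tb' fgc.
pose f x := F (elem_mx ord0 ord_max x) p q; pose g x := F (elem_mx ord_max ord0 x) q p.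
have {}FE x : F (elem_mx ord0 ord_max x) = elem_mx p q (f x) := FE x.
have {}FE' x : F (elem_mx ord_max ord0 x) = elem_mx q p (g x) := FE' x.
have elem_inj N (B : algType k) (s s' : 'I_N) : injective (fun x : B => elem_mx s s' x).
  by move=> x y /matrixP/(_ s s'); rewrite !mxE !eqxx.
have fL : linear f.
  move=> a x y; rewrite /f elem_mx_lin FL; [|exact: sl_elem|exact: sl_elem].
  by rewrite !mxE.
have finj : injective f.
  move=> x y e; apply: (elem_inj _ _ ord0 ord_max); apply: Finj; [exact: sl_elem|exact: sl_elem|].
  by rewrite !FE e.
have [f' f'K] : exists f', forall y, f (f' y) = y.
  apply: (functional_choice (fun y x => f x = y)) => y; have [x] := Fon y.
  by rewrite FE => /elem_inj e; exists x.
have fbij : bijective f by exists f' => // x; apply: finj.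
apply: (jordan_pair_alg_isomorphic (f := f) (g := g) _ (tU_domain tb') tbij tM fL fbij).
  by rewrite ((pcharf0P k).1 chk).
move=> x y z; apply: (elem_inj _ _ p q); rewrite -elem_triple // -!FE -FE' -elem_triple //.
by rewrite !Fbr //; try exact: sl_br; try exact: sl_elem.
Qed.

End Forward.

Theorem theorem11p4 (k : closedFieldType) (hk : [pchar k] =i pred0)
  (A A' : algType k) (n r : nat) :
  assoc_torus A n -> assoc_fgc A ->
  assoc_torus A' n -> assoc_fgc A' ->
  (1 <= r)%N ->
  assumptionC (@mat_sc k A r.+1) (@mat_br k A r.+1) (@sl_set k A r.+1) ->
  assumptionC (@mat_sc k A' r.+1) (@mat_br k A' r.+1) (@sl_set k A' r.+1) ->
  (lie_isomorphic (@mat_sc k A r.+1) (@mat_br k A r.+1) (@sl_set k A r.+1)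
                  (@mat_sc k A' r.+1) (@mat_br k A' r.+1) (@sl_set k A' r.+1)
   <-> alg_isomorphic A A').
Proof.
move=> torA _ torA' fgcA' r0 [_ _ conj] _.
split=> [[psi psi_isom]|]; last exact: alg_isomorphic_lie.
have [U [c tb]] := assoc_torus_basis torA.
have [U' [c' tb']] := assoc_torus_basis torA'.
have tor2 := lie_torus_transport (@mat_sc1 _ _ _) (@mat_sc1 _ _ _)
  (@sl_subspace k A r.+1) (fun x y _ _ => sl_br x y) psi_isom (sl_lie_torus tb' r0).
have [phi [phi_aut phiP]] := conj _ _ _ _ _ _ _ _ (sl_lie_torus tb r0) tor2.
(* [phi] carries the Cartan subalgebra over [A] to the preimage under [psi] of the one over [A'], so
   the composite matches the two. *)
have F_isom := lie_isom_comp phi_aut psi_isom.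
apply: (cartan_isom_alg_isomorphic hk tb tb' r0 F_isom _ fgcA') => H'.
have [_ _ _ psi_onto _] := psi_isom.
split=> [GH'|[H GH ->]]; last by have [] := (phiP (phi H)).2 (ex_intro2 _ _ H GH erefl).
have [Y slY psiY] := psi_onto H' GH'.1.
have [|H GH YE] := (phiP Y).1; first by rewrite psiY.
by exists H; rewrite //= -YE.
Qed.
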